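(* Let $\Gamma$ be a finitely generated group and suppose $\Gamma$ admits a decreasing chain $\Gamma_0\supseteq\Gamma_1\supseteq\Gamma_2\supseteq\dots$ of finite-index normal subgroups of $\Gamma$ with $\Gamma_k\cong\Gamma$ for all $k\geq 0$. Then there exist - a finitely generated nilpotent group $N$ such that $N/\operatorname{Tor}(N)$ is abelian, - a surjective homomorphism $\pi:\Gamma\to N$, and - finite-index normal subgroups $N_k\subseteq N$ (for $k\ge 1$), such that $\Gamma_k=\pi^{-1}(N_k)$ for every $k\geq 1$.
   Context: For a finitely generated nilpotent group $N$, $\operatorname{Tor}(N)$ denotes the set of torsion elements, which is a finite normal subgroup of $N$. The isomorphisms $\Gamma_k\cong\Gamma$ are isomorphisms of abstract groups. *)

(* Defs.v *)
From HB Require Import structures.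
From mathcomp Require Import all_boot.
From mathcomp Require Import boolp classical_sets functions cardinality.

Set Implicit Arguments.
Unset Strict Implicit.
Unset Printing Implicit Defensive.

Local Open Scope classical_set_scope.
Local Open Scope group_scope.

(* [groupType] carries a [choiceType] structure; classically every type has
   one (see [gen_choiceMixin] in boolp), so arbitrary, possibly infinite,
   groups are covered. Subsets of a group are Prop-valued sets. *)

Definition is_subgroup (G : groupType) (H : set G) : Prop :=
  group_closed [in H].

Definition normal_subgroup (G : groupType) (H : set G) : Prop :=
  is_subgroup H /\ forall x y : G, H x -> H (x ^ y).

Definition generated (G : groupType) (S : set G) : set G :=
  smallest (@is_subgroup G) S.

Definition finitely_generated (G : groupType) : Prop :=
  exists2 S : set G, finite_set S & generated S = [set: G].

Definition left_coset (G : groupType) (x : G) (H : set G) : set G :=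
  [set x * h | h in H].

Definition left_cosets (G : groupType) (H : set G) : set (set G) :=
  [set left_coset x H | x in [set: G]].

Definition finite_index (G : groupType) (H : set G) : Prop :=
  finite_set (left_cosets H).

(* For H and K subgroups: H and K are isomorphic as abstract groups. Only the
   restriction of f to H matters. *)
Definition isomorphic_subgroups (G G' : groupType) (H : set G) (K : set G') :
    Prop :=
  exists f : G -> G',
    set_bij H K f /\ forall x y : G, H x -> H y -> f (x * y) = f x * f y.

Fixpoint lower_central (G : groupType) (n : nat) : set G :=
  if n is m.+1 then
    generated [set [~ x, y] | x in @lower_central G m & y in [set: G]]
  else [set: G].

Arguments lower_central : clear implicits.

Definition nilpotent_group (G : groupType) : Prop :=
  exists n : nat, lower_central G n = [set 1].

Definition torsion (G : groupType) : set G :=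
  [set x | exists2 n : nat, (0 < n)%N & x ^+ n = 1].

Arguments torsion : clear implicits.

Definition set_product (G : groupType) (A B : set G) : set G :=
  [set a * b | a in A & b in B].

(* For H normal, the elements of the quotient group G / H are the cosets of H
   and its law is the elementwise product of cosets. *)
Definition abelian_quotient (G : groupType) (H : set G) : Prop :=
  forall A B : set G, left_cosets H A -> left_cosets H B ->
    set_product A B = set_product B A.

(* Main.v *)
Require Import Defs.
From HB Require Import structures.
From mathcomp Require Import all_boot.
From mathcomp Require Import boolp classical_sets functions cardinality.

(** Write G_k for the k-th subgroup of the chain, g_i for the i-th term of the
    lower central series (g_1 = G), and let H be a finite-index normal subgroup
    of G which is the image of an injective endomorphism phi.

    G / H is nilpotent.  If E is a fully invariant subgroup of finite index then
    |E : phi E| = |G : H|, whatever E is, so a fixed subgroup F of finite index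
    centralises all the quotients E / phi E.  As the iterated images H_i of phi
    have stable image in G / F and H_{i+1} is normal in H_i, counting cosets
    shows that some H_i, independent of E, acts nilpotently on every E / phi E.
    For E small enough this forces H_i / H_{i+1}, which is a copy of G / H, to
    be nilpotent.

    [G_k, G_k] is contained in all G_l for some k.  Let tau be the isolator of
    g_2 in G.  Comparing ranks, [H, G] lies in phi(tau), which is finite modulo
    phi(g_2).  Hence, for every fully invariant W of finite index in tau, the
    action of G on H / phi(W) has a kernel of index bounded independently of
    phi; so one subgroup F of finite index satisfies [G_k, F] <= phi_k(W) for
    all k, and G_k <= G_l F for some k and all l >= k.  Thus [G_k, G_k] lies in
    phi_k(W) G_l.  On the other hand g_2 ^ e <= g_3 H for an exponent e that
    does not depend on H: the automorphisms of G induced by conjugation on H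
    have an inner power, and the torsion of the group of such automorphisms
    modulo inner ones is bounded.  With W = g_2 ^ e g_3 and the nilpotency of
    G_k / G_l one gets [G_k, G_k] <= G_l.

    The group N is the quotient of G by the intersection M of the G_k.  It is
    nilpotent because [G_k, G] is finite modulo M, and its derived subgroup is
    torsion by the exponent bound. *)

Set Implicit Arguments.
Unset Strict Implicit.
Unset Printing Implicit Defensive.

Local Open Scope classical_set_scope.
Local Open Scope group_scope.

(** * Subgroups, homomorphisms and quotient groups *)

Lemma is_subgroupP (G : groupType) (H : set G) :
  is_subgroup H <->
  [/\ H 1, forall x y, H x -> H y -> H (x * y) & forall x, H x -> H x^-1].
Proof.
have inH z : (z \in [in H]) <-> H z by split; rewrite inE /= ?inE.
split=> [[/inH H1 Hd]|[H1 HM HV]].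
  have HV x : H x -> H x^-1.
    by move=> Hx; rewrite -[_^-1]mul1g; apply/inH/Hd; apply/inH.
  split=> // x y Hx Hy; rewrite -[y]invgK.
  by apply/inH/Hd; apply/inH => //; exact: HV.
by split=> [|x y /inH Hx /inH Hy]; apply/inH => //; apply: HM => //; exact: HV.
Qed.

Section SubgroupTheory.
Context {G : groupType} {H : set G}.

Lemma subg1 : is_subgroup H -> H 1.
Proof. by case/is_subgroupP. Qed.

Lemma subgM : is_subgroup H -> forall x y, H x -> H y -> H (x * y).
Proof. by case/is_subgroupP. Qed.

Lemma subgV : is_subgroup H -> forall x, H x -> H x^-1.
Proof. by case/is_subgroupP. Qed.

Lemma subgX : is_subgroup H -> forall x n, H x -> H (x ^+ n).
Proof.
move=> sH x n Hx; elim: n => [|n IHn]; first exact: subg1.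
by rewrite expgS; apply: subgM.
Qed.

Lemma normJ : normal_subgroup H -> forall x y, H x -> H (x ^ y).
Proof. by case. Qed.

Lemma normRl : normal_subgroup H -> forall x y, H x -> H [~ x, y].
Proof.
by move=> [sH nH] x y Hx; apply: subgM => //; [exact: subgV|exact: nH].
Qed.

Lemma normRr : normal_subgroup H -> forall x y, H y -> H [~ x, y].
Proof.
by move=> nH x y Hy; rewrite -invgR; apply: subgV; [case: nH|exact: normRl].
Qed.

End SubgroupTheory.

Lemma subgroup_setT (G : groupType) : is_subgroup [set: G].
Proof. by apply/is_subgroupP. Qed.

Section MorphTheory.
Context {G X : groupType} {f : G -> X}.
Hypothesis fM : {morph f : x y / x * y}.

Lemma morph1 : f 1 = 1.
Proof. by apply: (@mulgI _ (f 1)); rewrite -fM !mulg1. Qed.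

Lemma morphV : {morph f : x / x^-1}.
Proof. by move=> x; apply: (@mulgI _ (f x)); rewrite -fM !mulgV morph1. Qed.

Lemma morphX n : {morph f : x / x ^+ n}.
Proof. by move=> x; elim: n => [|n IHn]; rewrite ?morph1 // !expgS fM IHn. Qed.

Lemma morphJ : {morph f : x y / x ^ y}.
Proof. by move=> x y; rewrite /conjg !fM morphV. Qed.

Lemma morphR : {morph f : x y / [~ x, y]}.
Proof. by move=> x y; rewrite /commg fM morphV morphJ. Qed.

Lemma preimage_subgroup (H : set X) : is_subgroup H -> is_subgroup (f @^-1` H).
Proof.
move=> sH; apply/is_subgroupP; split=> /= [|x y Hx Hy|x Hx].
- by rewrite morph1; apply: subg1.
- by rewrite fM; apply: subgM.
- by rewrite morphV; apply: subgV.
Qed.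

Lemma preimage_normal (H : set X) :
  normal_subgroup H -> normal_subgroup (f @^-1` H).
Proof.
move=> [sH nH]; split; first exact: preimage_subgroup.
by move=> x y /= Hx; rewrite morphJ; apply: nH.
Qed.

Lemma image_subgroup (H : set G) : is_subgroup H -> is_subgroup (f @` H).
Proof.
move=> sH; apply/is_subgroupP; split.
- by exists 1; [exact: subg1|exact: morph1].
- move=> _ _ [x Hx <-] [y Hy <-]; exists (x * y); last exact: fM.
  exact: subgM.
- by move=> _ [x Hx <-]; exists x^-1; [exact: subgV|exact: morphV].
Qed.

End MorphTheory.

(* The carrier is the set of left cosets of [K], a subtype of the choice type
   [set G]. *)
Lemma quotient_group (G : groupType) (K : set G) : normal_subgroup K ->
  exists (X : groupType) (f : G -> X),
    [/\ {morph f : x y / x * y}, forall z, exists x, f x = z,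
        forall x y, f x = f y <-> K (x^-1 * y) & forall x, f x = 1 <-> K x].
Proof.
move=> nK; have sK : is_subgroup K by case: nK.
pose cos x := [set y | K (x^-1 * y)].
have cosP x y : cos x = cos y <-> K (x^-1 * y).
  split=> [e|Kxy].
    by have : cos y y; [rewrite /cos /= mulVg; apply: subg1|rewrite -e].
  apply/seteqP; split=> z; rewrite /cos /= => Kz.
    have -> : y^-1 * z = (x^-1 * y)^-1 * (x^-1 * z) by rewrite !gnorm.
    by apply: subgM => //; apply: subgV.
  have -> : x^-1 * z = (x^-1 * y) * (y^-1 * z) by rewrite !gnorm.
  exact: subgM.
pose T := {A : set G | `[< exists x, A = cos x >]}.
have Tcos x : `[< exists y, cos x = cos y >] by apply/asboolP; exists x.
have [f [fP fS]] : exists f : G -> T,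
    (forall x y, f x = f y <-> K (x^-1 * y)) /\ forall z, exists x, f x = z.
  exists (fun x => exist _ (cos x) (Tcos x)); split=> [x y|[A pA]].
    by rewrite -cosP; split=> [[]//|e]; apply: val_inj.
  by have /asboolP[x Ax] := pA; exists x; apply: val_inj.
have [g gK] := choice fS.
have fgM x y : f (g (f x) * g (f y)) = f (x * y).
  apply/fP; rewrite invgM -mulgA.
  have /fP Kx := gK (f x); have /fP Ky := gK (f y).
  have -> : (g (f y))^-1 * ((g (f x))^-1 * (x * y)) =
     ((g (f x))^-1 * x) ^ g (f y) * ((g (f y))^-1 * y).
    by rewrite /conjg !gnorm.
  by apply: subgM => //; case: nK => _; apply.
have fgV x : f (g (f x))^-1 = f x^-1.
  apply/fP; rewrite invgK; have /fP Kx := gK (f x).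
  have -> : g (f x) * x^-1 = (((g (f x))^-1 * x) ^ (g (f x))^-1)^-1.
    by rewrite /conjg !gnorm.
  by apply: subgV => //; case: nK => _; apply.
pose mul (u v : T) := f (g u * g v).
pose inv (u : T) := f (g u)^-1.
have mulA : associative mul.
  move=> u v w; have [[[x <-] [y <-]] [z <-]] := (fS u, fS v, fS w).
  by rewrite /mul (fgM y) (fgM x y) !fgM mulgA.
have mul1 : left_id (f 1) mul.
  by move=> u; have [x <-] := fS u; rewrite /mul fgM mul1g.
have mulr1 : right_id (f 1) mul.
  by move=> u; have [x <-] := fS u; rewrite /mul fgM mulg1.
have mulV : left_inverse (f 1) inv mul.
  by move=> u; have [x <-] := fS u; rewrite /mul /inv fgV fgM mulVg.
have mulrV : right_inverse (f 1) inv mul.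
  by move=> u; have [x <-] := fS u; rewrite /mul /inv fgV fgM mulgV.
pose X : groupType := HB.pack T (isGroup.Build T mulA mul1 mulr1 mulV mulrV).
exists X, f; split=> // [x y|x]; first exact/esym/fgM.
by split=> [/esym/fP|Kx]; [|apply/esym/fP]; rewrite invg1 mul1g.
Qed.

(** * Index *)

(* [A] meets at most [n] left cosets of [K] (neither set has to be a subgroup,
   nor [K] to be contained in [A]). *)
Definition index_le (G : groupType) (n : nat) (A K : set G) : Prop :=
  exists (I : finType) (f : G -> I),
    (#|I| <= n)%N /\ forall x y, A x -> A y -> f x = f y -> K (x^-1 * y).

Section IndexTheory.
Context {G : groupType}.
Implicit Types (A B K : set G).

Lemma index_leS n A B K : B `<=` A -> index_le n A K -> index_le n B K.
Proof.
move=> BA [I [f [In fP]]]; exists I, f; split=> // x y /BA Ax /BA Ay.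
exact: fP.
Qed.

Lemma index_leW m n A K : (m <= n)%N -> index_le m A K -> index_le n A K.
Proof.
move=> mn [I [f [Im fP]]]; exists I, f; split=> //; exact: leq_trans mn.
Qed.

Lemma finite_index_le K : is_subgroup K -> finite_index K ->
  exists n, index_le n [set: G] K.
Proof.
move=> sK /finite_seqP[s sP].
have sx x : left_coset x K \in s.
  by have : [set` s] (left_coset x K); [rewrite -sP; exists x|].
pose f x : 'I_(size s) := Ordinal (etrans (index_mem _ _) (sx x)).
exists (size s), 'I_(size s), f; split=> [|x y _ _ [exy]].
  by rewrite card_ord.
have {}exy : left_coset x K = left_coset y K.
  by rewrite -(nth_index set0 (sx x)) exy nth_index.
have : left_coset y K y by exists 1; [exact: subg1|rewrite mulg1].
by rewrite -exy => -[h Kh <-]; rewrite mulKg.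
Qed.

Lemma index_le_finite n K : is_subgroup K -> index_le n [set: G] K ->
  finite_index K.
Proof.
move=> sK [I [f [_ fP]]].
pose F (i : I) := left_coset (xget 1 [set x | f x = i]) K.
apply: (@sub_finite_set _ _ (F @` [set: I])).
  move=> _ [x _ <-]; exists (f x) => //; rewrite /F.
  set y := xget _ _.
  have fy : f y = f x.
    by rewrite /y; case: xgetP => [z _ //|/(_ x)]; case.
  apply/seteqP; split=> _ [h Kh <-].
    exists (x^-1 * y * h); last by rewrite -!mulgA mulVKg.
    by apply: subgM => //; apply: fP.
  exists (y^-1 * x * h); last by rewrite -!mulgA mulVKg.
  by apply: subgM => //; apply: fP.
exact/finite_image/finite_finset.
Qed.

Lemma index_le_trans m n A K' K : is_subgroup K' ->
  index_le m A K' -> index_le n K' K -> index_le (m * n) A K.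
Proof.
move=> sK' [I [f [Im fP]]] [J [g [Jn gP]]].
pose r i := xget 1 [set x | A x /\ f x = i].
have rP x : A x -> K' ((r (f x))^-1 * x).
  move=> Ax; rewrite /r; case: xgetP => [y _ [Ay fy]|/(_ x)]; last by case.
  exact: fP.
exists (I * J)%type, (fun x => (f x, g ((r (f x))^-1 * x))).
split=> [|x y Ax Ay [exy]]; first by rewrite card_prod leq_mul.
rewrite -exy => /gP + ; rewrite invgM invgK -mulgA mulVKg; apply;
  first exact: rP.
by rewrite exy; apply: rP.
Qed.

Lemma coset_representatives A K : is_subgroup K ->
  exists c : G -> G, (forall x, A x -> A (c x) /\ K (x^-1 * c x)) /\
    forall x y, K (x^-1 * y) -> c x = c y.
Proof.
move=> sK; exists (fun x => xget 1 [set y | A y /\ K (x^-1 * y)]); split.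
  move=> x Ax; case: xgetP => [y _ []//|/(_ x)]; case.
  by rewrite /= mulVg; split=> //; apply: subg1.
move=> x y Kxy; congr (xget _ _); apply/seteqP.
split=> z /= [Az Kz]; split=> //.
  have -> : y^-1 * z = (x^-1 * y)^-1 * (x^-1 * z) by rewrite !gnorm.
  by apply: subgM => //; apply: subgV.
have -> : x^-1 * z = (x^-1 * y) * (y^-1 * z) by rewrite !gnorm.
exact: subgM.
Qed.

(** The lower bound that matches [index_le]; the two together pin down an index without
    cardinals. *)
Definition separated (n : nat) A K : Prop :=
  exists x : 'I_n -> G,
    (forall i, A (x i)) /\ forall i j, K ((x i)^-1 * x j) -> i = j.

Lemma separated_le m n A K : index_le m A K -> separated n A K -> (n <= m)%N.
Proof.
move=> [I [f [Im fP]]] [x [xA xP]]; apply: leq_trans Im.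
rewrite -[n in (n <= _)%N]card_ord -(card_codom (f := fun i => f (x i))).
  exact: max_card.
by move=> i j /fP H; apply: xP; apply: H.
Qed.

Lemma index_exact n A K : is_subgroup K -> A !=set0 -> index_le n A K ->
  exists m, index_le m A K /\ separated m A K.
Proof.
move=> sK [a Aa] [I [f [In fP]]].
have [c [cP cK]] := coset_representatives A sK.
have cc x : A x -> c (c x) = c x by move=> /cP[_ /cK].
(* Only the labels of the canonical representatives [c x] are kept. Distinct ones belong to distinct
   cosets, so their number is the exact index. *)
pose P : {pred I} := fun i => `[< exists2 x, A x & f (c x) = i >].
have PA x : A x -> f (c x) \in P by move=> Ax; apply/asboolP; exists x.
have /choice[r rP] (i : 'I_#|P|) : exists x, A x /\ f (c x) = enum_val i.
  by have /asboolP[x Ax fx] := enum_valP i; exists x.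
exists #|P|; split.
  exists 'I_#|P|, (fun x => enum_rank_in (PA a Aa) (f (c x))).
  split=> [|x y Ax Ay exy]; first by rewrite card_ord.
  have {}exy : f (c x) = f (c y).
    by rewrite -(enum_rankK_in (PA a Aa) (PA x Ax)) exy enum_rankK_in // PA.
  have [[Acx Kx] [Acy Ky]] := (cP _ Ax, cP _ Ay).
  have -> : x^-1 * y = (x^-1 * c x) * ((c x)^-1 * c y) * (y^-1 * c y)^-1.
    by rewrite !gnorm.
  apply: subgM => //; last exact: subgV.
  by apply: subgM => //; apply: fP.
exists (fun i => r i); split=> [i|i j /cK e]; first by case: (rP i).
by apply: enum_val_inj; rewrite -(rP i).2 -(rP j).2 e.
Qed.

Lemma separatedM m n A B K : is_subgroup A -> is_subgroup B ->
  B `<=` A -> K `<=` B -> separated m A B -> separated n B K ->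
  separated (m * n) A K.
Proof.
move=> sA sB BA KB [x [xA xP]] [y [yB yP]].
pose p (k : 'I_(m * n)) : 'I_m * 'I_n :=
  enum_val (cast_ord (esym (etrans (card_prod _ _) (f_equal2 muln (card_ord m)
    (card_ord n)))) k).
have p_inj : injective p by move=> i j /enum_val_inj /cast_ord_inj.
exists (fun k => x (p k).1 * y (p k).2); split=> [k|i j Kij].
  by apply: subgM => //; apply: BA.
apply: p_inj; move: Kij; case: (p i) => i1 i2; case: (p j) => j1 j2 /= Kij.
have e1 : i1 = j1.
  apply: xP; have := KB _ Kij; rewrite invgM => Bij.
  have -> : (x i1)^-1 * x j1 =
    y i2 * ((y i2)^-1 * (x i1)^-1 * (x j1 * y j2)) * (y j2)^-1.
    by rewrite !gnorm.
  by do ?[apply: subgM => //|apply: subgV => //].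
move: Kij; rewrite e1 invgM -mulgA mulKg => /yP e2.
by rewrite e2.
Qed.

Lemma stabilise n D F (A : nat -> set G) : index_le n D F -> A 0%N `<=` D ->
  (forall k, A k.+1 `<=` A k) ->
  exists k, forall l, (k <= l)%N ->
    forall x, A k x -> exists2 y, A l y & F (y^-1 * x).
Proof.
move=> [I [f [_ fP]]] AD Adecr.
have Ale k l : (k <= l)%N -> A l `<=` A k.
  by move/subnKC <-; elim: (l - k)%N => [|m IHm];
    rewrite ?addn0 ?addnS // => x /Adecr/IHm.
pose S k := [pred i : I | `[< exists2 x, A k x & f x = i >]].
have exS : exists m, `[< exists k, #|S k| = m >].
  by exists #|S 0%N|; apply/asboolP; exists 0%N.
case: (ex_minnP exS) => _ /asboolP[k <-] kmin; exists k => l kl x Akx.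
have Slk : {subset S l <= S k}.
  move=> i /asboolP[y Aly fy].
  by apply/asboolP; exists y => //; apply: Ale Aly.
have /fintype.subsetP/subset_leqif_card := Slk.
have : (#|S k| <= #|S l|)%N by apply: kmin; apply/asboolP; exists l.
move=> kl' [lk' ee]; have : #|S l| == #|S k| by rewrite eqn_leq lk' kl'.
rewrite ee => /fintype.subsetP/(_ (f x)) Skl.
have /Skl/asboolP[y Aly fyx] : f x \in S k by apply/asboolP; exists x.
exists y => //.
by apply: fP => //; apply: AD; [apply: Ale Aly|apply: Ale Akx].
Qed.

(* Pigeonhole on the powers of [x]. *)
Lemma index_le_expg n A K x : is_subgroup A -> index_le n A K -> A x ->
  exists m, [/\ (0 < m)%N, (m <= n)%N & K (x ^+ m)].
Proof.
move=> sA [I [f [In fP]]] Ax.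
have /injectivePn[i [j ij eij]] : ~~ injectiveb (fun i : 'I_n.+1 => f (x ^+ i)).
  apply/negP => /injectiveP/leq_card; rewrite card_ord => /leq_trans/(_ In).
  by rewrite ltnn.
wlog lij : i j ij eij / (i < j)%N.
  move=> H; have : (i != j :> nat) by [].
  by rewrite neq_ltn => /orP[?|?]; [apply: (H i j)|apply: (H j i) => //;
    rewrite eq_sym].
exists (j - i)%N; split; first by rewrite subn_gt0.
  by rewrite (leq_trans (leq_subr i j)) // -ltnS.
have -> : x ^+ (j - i) = (x ^+ i)^-1 * x ^+ j.
  by rewrite -(subnKC (ltnW lij)) addKn expgnDr mulKg.
by apply: fP => //; apply: subgX.
Qed.

End IndexTheory.

Lemma index_le_image (G X : groupType) (f : G -> X) n (A K : set G) :
  {morph f : x y / x * y} -> injective f ->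
  index_le n A K -> index_le n (f @` A) (f @` K).
Proof.
move=> fM f_inj [I [g [In gP]]].
exists I, (fun x => g (xget 1 [set y | f y = x])); split=> //.
have fK z : xget 1 [set y | f y = f z] = z.
  by case: xgetP => [t _ /f_inj//|/(_ z)]; case.
move=> _ _ [x Ax <-] [y Ay <-]; rewrite !fK => /(gP _ _ Ax Ay) Kxy.
by exists (x^-1 * y); rewrite ?fM ?(morphV fM).
Qed.

(** * Fully invariant subgroups of finite index *)

Definition spans (G : groupType) (s : seq G) : Prop :=
  forall A : set G, is_subgroup A -> (forall x, x \in s -> A x) -> forall x,
    A x.

Lemma finitely_generated_spans (G : groupType) :
  finitely_generated G -> exists s : seq G, spans s.
Proof.
move=> [S /finite_seqP[s ->] gS]; exists s => A sA As x.
have : generated [set` s] x by rewrite gS.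
exact.
Qed.

Definition fully_invariant (G : groupType) (E : set G) : Prop :=
  is_subgroup E /\
  forall f : G -> G, {morph f : x y / x * y} -> forall x, E x -> E (f x).

Lemma fully_invariant_normal (G : groupType) (E : set G) :
  fully_invariant E -> normal_subgroup E.
Proof.
move=> [sE iE]; split=> // x y Ex.
by apply: (iE (fun z => z ^ y)) => // u v; rewrite conjMg.
Qed.

(** Point stabilisers of an action on at most [n] points have index at most [n], so this subgroup
    acts trivially in all such actions at once. *)
Definition low_index (G : groupType) (n : nat) : set G :=
  [set x | forall K : set G, is_subgroup K -> index_le n [set: G] K -> K x].

Arguments low_index : clear implicits.

Lemma low_index_fully_invariant (G : groupType) n :
  fully_invariant (low_index G n).
Proof.
split=> [|f fM x Ex K sK [I [g [In gP]]]].
  apply/is_subgroupP; split=> [K sK _|x y Ex Ey K sK iK|x Ex K sK iK].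
  - exact: subg1.
  - by apply: subgM => //; [apply: Ex|apply: Ey].
  - by apply: subgV => //; apply: Ex.
apply: (Ex (f @^-1` K)); first exact: preimage_subgroup.
exists I, (g \o f); split=> // u v _ _ /= /gP.
by rewrite fM morphV //; apply.
Qed.

(* A subgroup [K] of index at most [n] is determined by the action of the
   generators and their inverses on the cosets of [K], labelled by ['I_n], and
   by the label of [K] itself; there are finitely many such data. *)
Lemma low_index_finite (G : groupType) (s : seq G) n : spans s ->
  exists m, index_le m [set: G] (low_index G n).
Proof.
move=> ss.
pose label K (f : G -> 'I_n) := forall x y, f x = f y <-> K (x^-1 * y).
have labelP K : is_subgroup K -> index_le n [set: G] K -> exists f, label K f.
  move=> sK [J [g [In gP]]].
  have [c [cP cK]] := coset_representatives [set: G] sK.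
  exists (fun x => widen_ord In (enum_rank (g (c x)))) => x y.
  split=> [[/ord_inj/enum_rank_inj e]|/cK -> //].
  have -> : x^-1 * y = (x^-1 * c x) * ((c x)^-1 * c y) * (y^-1 * c y)^-1.
    by rewrite !gnorm.
  have [[_ Kx] [_ Ky]] := (cP x I, cP y I).
  apply: subgM => //; last exact: subgV.
  by apply: subgM => //; apply: gP.
pose s' := s ++ [seq x^-1 | x <- s].
pose T := ({ffun 'I_(size s') * 'I_n -> 'I_n} * 'I_n)%type.
pose data (f : G -> 'I_n) : T :=
  ([ffun p : 'I_(size s') * 'I_n =>
    f (nth 1 s' p.1 * xget 1 [set x | f x = p.2])], f 1).
have labelM K f g x y : label K f -> f x = f y -> f (g * x) = f (g * y).
  by move=> lf /lf Kxy; apply/lf; rewrite invgM -mulgA mulKg.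
have dataE K f i x (lf : label K f) (si : (i < size s')%N) :
    (data f).1 (Ordinal si, f x) = f (nth 1 s' i * x).
  rewrite ffunE /=; apply: labelM (lf) _.
  by case: xgetP => [//|/(_ x)]; case.
have data_inj K K' f f' : label K f -> label K' f' -> data f = data f' ->
  f =1 f'.
  move=> lf lf' e.
  have s'P g : g \in s' -> forall x y, f x = f' y -> f (g * x) = f' (g * y).
    move=> /(nthP 1)[i si <-] x y exy.
    by rewrite -(dataE _ _ _ x lf si) -(dataE _ _ _ y lf' si) e exy.
  pose A := [set g | forall x y, f x = f' y ->
    f (g * x) = f' (g * y) /\ f (g^-1 * x) = f' (g^-1 * y)].
  have sA : is_subgroup A.
    apply/is_subgroupP; split=> [x y|g h Ag Ah x y exy|g Ag x y /Ag[]].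
    - by rewrite invg1 !mul1g.
    - rewrite invgM -!mulgA; have [/Ag[-> _] _] := Ah _ _ exy.
      by have [_ /Ah[_ ->]] := Ag _ _ exy.
    - by rewrite invgK.
  move=> x; have /(_ 1 1) : A x.
    apply: (ss A sA) => g gs y z eyz; split; apply: s'P => //.
      by rewrite mem_cat gs.
    by rewrite mem_cat map_f ?orbT.
  by rewrite !mulg1; case=> //; case: e.
pose good t f := (exists2 K, is_subgroup K & label K f) /\ data f = t.
(* One labelling is chosen for each realised datum [t]; by [data_inj] it agrees with every labelling
   that has this datum. *)
pose F (t : T) g : option 'I_n :=
  if pselect (exists f, good t f) is left H then Some (sval (cid H) g) else
    None.
exists #|{ffun T -> option 'I_n}|, {ffun T -> option 'I_n}, (fun g =>
  [ffun t => F t g]).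
split=> // x y _ _ /ffunP exy K sK /(labelP _ sK)[f lf].
have := exy (data f); rewrite !ffunE /F.
case: pselect => [H|[]]; last by exists f; split=> //; exists K.
case: cid => f' /= [[K' _ lf'] /esym e] [].
by rewrite -!(data_inj _ _ _ _ lf lf' e) => /lf.
Qed.

Section RegularEndomorphism.
Context {G : groupType} {phi : G -> G} {q : nat}.
Hypothesis phiM : {morph phi : x y / x * y}.
Hypothesis phi_inj : injective phi.
Hypothesis phi_normal : normal_subgroup (range phi).
Hypothesis phi_index : index_le q [set: G] (range phi).

(** As [range phi] is normal, conjugation on it pulls back through [phi] to an endomorphism of [G].
    Hence images of fully invariant subgroups are normal. *)
Lemma conj_endo g : exists f : G -> G,
  {morph f : x y / x * y} /\ forall x, phi (f x) = phi x ^ g.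
Proof.
have /choice[f fP] x : exists y, phi y = phi x ^ g.
  have [y _ yP] : range phi (phi x ^ g) by apply: normJ => //; exists x.
  by exists y.
exists f; split=> // x y; apply: phi_inj.
by rewrite phiM !fP phiM conjMg.
Qed.

Lemma image_normal (E : set G) :
  fully_invariant E -> normal_subgroup (phi @` E).
Proof.
move=> [sE iE]; split; first exact: image_subgroup.
move=> _ g [x Ex <-]; have [f [fM fP]] := conj_endo g.
by exists (f x); [exact: iE|rewrite fP].
Qed.

Lemma image_sub (E : set G) : fully_invariant E -> phi @` E `<=` E.
Proof. by move=> [_ iE] _ [x Ex <-]; apply: iE. Qed.

(* Both |G : phi G| |phi G : phi E| and |G : E| |E : phi E| count the cosets
   of phi E in G, and |G : E| = |phi G : phi E|. *)
Lemma index_image (E : set G) n : fully_invariant E -> index_le n [set: G] E ->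
  index_le q E (phi @` E).
Proof.
move=> fE iE; have [sE _] := fE.
have sphiE : is_subgroup (phi @` E) by case: (image_normal fE).
have T0 : [set: G] !=set0 by exists 1.
have E0 : E !=set0 by exists 1; apply: subg1.
have [r [ir sr]] := index_exact sE T0 iE.
have iphi := index_le_image phiM phi_inj ir.
have i1 : index_le (q * r) [set: G] (phi @` E).
  by apply: index_le_trans phi_index iphi; case: phi_normal.
have [t [it st]] := index_exact sphiE E0 (index_leS (@subsetT _ E) i1).
apply: index_leW it.
have : (r * t <= q * r)%N.
  apply: separated_le i1 _.
  exact: separatedM (subgroup_setT G) sE _ (image_sub fE) sr st.
rewrite mulnC leq_pmul2r //.
have [I [f [Ir _]]] := ir; apply: leq_trans Ir.
by apply/card_gt0P; exists (f 1).
Qed.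

End RegularEndomorphism.

(** * Nilpotency of the quotient *)

(** Left-normed commutators [[...[[x, s_1], s_2], ..., s_n]]. *)
Notation lcomm := (foldl (@commg _)).

Lemma morph_lcomm (G X : groupType) (f : G -> X) : {morph f : x y / x * y} ->
  forall x s, f (lcomm x s) = lcomm (f x) (map f s).
Proof. by move=> fM x s; elim: s x => //= y s IHs x; rewrite IHs morphR. Qed.

Lemma lcomm_mem (G : groupType) (E : set G) : normal_subgroup E ->
  forall x s, E x -> E (lcomm x s).
Proof.
by move=> nE x s; elim: s x => //= y s IHs x Ex; apply/IHs/normRl.
Qed.

Lemma generated_sub (G : groupType) (S A : set G) :
  is_subgroup A -> S `<=` A -> generated S `<=` A.
Proof. by move=> sA SA x; apply. Qed.

(** Induction on [c], passing from [H] to the normal subgroup [Z] of elements that are central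
    modulo [H]. *)
Lemma lower_central_lcomm (G : groupType) (H : set G) c : normal_subgroup H ->
  (forall x s, size s = c -> H (lcomm x s)) -> lower_central G c `<=` H.
Proof.
elim: c H => [|c IHc] H nH HP; first by move=> x _; apply: (HP x [::]).
pose Z := [set x | forall y, H [~ x, y]].
have nZ : normal_subgroup Z.
  have sH : is_subgroup H by case: nH.
  split.
    apply/is_subgroupP; split=> [y|x y Zx Zy z|x Zx y].
    - by rewrite comm1g; apply: subg1.
    - have -> : [~ x * y, z] = [~ x, z] ^ y * [~ y, z].
        by rewrite /commg /conjg !gnorm.
      by apply: subgM => //; apply: normJ.
    - have -> : [~ x^-1, y] = ([~ x, y] ^ x^-1)^-1.
        by rewrite /commg /conjg !gnorm.
      by apply: subgV => //; apply: normJ.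
  move=> x y Zx z; have -> : [~ x ^ y, z] = [~ x, z ^ y^-1] ^ y.
    by rewrite conjRg conjgKV.
  exact: normJ.
have {}IHc : lower_central G c `<=` Z.
  apply: IHc => // x s sc y.
  by have := HP x (rcons s y); rewrite foldl_rcons size_rcons sc; apply.
by apply: generated_sub => [|_ [x /IHc Zx [y _ <-]]]; [case: nH|apply: Zx].
Qed.

Section NilpotentQuotient.
Context {G : groupType} {phi : G -> G} {q : nat} {gs : seq G}.
Hypothesis gsP : spans gs.
Hypothesis phiM : {morph phi : x y / x * y}.
Hypothesis phi_inj : injective phi.
Hypothesis phi_normal : normal_subgroup (range phi).
Hypothesis phi_index : index_le q [set: G] (range phi).

Let H i : set G := range (iter i phi).

Let iterM i : {morph iter i phi : x y / x * y}.
Proof. by elim: i => // i IHi x y /=; rewrite IHi phiM. Qed.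

Let iter_inj i : injective (iter i phi).
Proof. by elim: i => // i IHi x y /= /phi_inj/IHi. Qed.

Let HS i j : (i <= j)%N -> H j `<=` H i.
Proof.
move=> /subnKC <- _ [x _ <-]; rewrite iterD.
by exists (iter (j - i) phi x).
Qed.

Let sH i : is_subgroup (H i).
Proof. exact/image_subgroup/subgroup_setT. Qed.

Let H_index i : exists n, index_le n [set: G] (H i).
Proof.
elim: i => [|i [n IHi]].
  exists 1%N, unit, (fun=> tt); split=> [|x y _ _ _];
    first by rewrite card_unit.
  by exists (x^-1 * y).
exists (n * q)%N; apply: index_le_trans IHi _; first exact: sH.
have := index_le_image (iterM i) (@iter_inj i) phi_index.
congr (index_le _ _ _); apply/seteqP; split=> [_ [_ [x _ <-] <-]|_ [x _ <-]].
  by exists x => //; rewrite iterSr.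
by rewrite iterSr; exists (phi x) => //; exists x.
Qed.

(* Otherwise [z = lcomm x s] lies in [E] but not in [phi E], and since [H j.+1]
   is normal in [H j] it lies in [H n.+1] as well; then the elements
   [iter j phi z], [j <= n], lie in distinct cosets of [iter n.+1 phi @` E] in
   [H n.+1], which has at most [n] of them. *)
Lemma lcomm_image n (E : set G) : fully_invariant E -> index_le n [set: G] E ->
  forall x s, E x -> size s = n.+1 -> (forall y, y \in s -> H n.+1 y) ->
    (phi @` E) (lcomm x s).
Proof.
move=> fE iE x s Ex sn sH'; apply: contrapT => nz.
set z := lcomm x s in nz.
have Ez : E z by apply: lcomm_mem => //; exact: fully_invariant_normal.
have Hz : H n.+1 z.
  have : forall m t, (size t + m <= n.+1)%N -> (forall y,
    y \in t -> H n.+1 y) ->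
      forall x, H m x -> H (m + size t)%N (lcomm x t).
    move=> m t; elim: t m => [|y t IHt] m /= mt tH u Hu; first by rewrite addn0.
    rewrite addnS -addSn; apply: IHt.
    - by rewrite addnS.
    - by move=> v vt; apply: tH; rewrite inE vt orbT.
    have [u' _ <-] := Hu.
    have [v _ <-] : H m.+1 y.
      apply: (@HS m.+1 n.+1); last by apply: tH; rewrite inE eqxx.
      by apply: leq_trans mt; rewrite addSn ltnS leq_addl.
    have [w _ wP] : range phi [~ u', phi v] by apply: normRr => //; exists v.
    by exists w => //; rewrite iterSr wP (morphR (iterM m)) iterSr.
  by move=> /(_ 0%N s); rewrite addn0 sn; apply=> //; exists x.
have EW j k : (iter j phi @` E) (iter (j + k) phi z).
  rewrite iterD; exists (iter k phi z) => //.
  by elim: k => //= k IHk; apply: fE.2.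
have nEW j : ~ (iter j.+1 phi @` E) (iter j phi z).
  by move=> [w Ew]; rewrite iterSr => /iter_inj wz; apply: nz; exists w.
have sEW j : is_subgroup (iter j phi @` E).
  by apply: image_subgroup; [exact: iterM|case: fE].
have EWS j k : (j <= k)%N -> iter k phi @` E `<=` iter j phi @` E.
  move=> /subnKC <- _ [w Ew <-]; rewrite iterD.
  exists (iter (k - j) phi w) => //.
  by elim: (k - j)%N => //= m IHm; apply: fE.2.
have : (n.+1 <= n)%N; last by rewrite ltnn.
apply: (@separated_le _ n n.+1 (H n.+1) (iter n.+1 phi @` E)).
  exact: index_le_image (iterM _) (@iter_inj _) iE.
exists (fun i => iter i phi z); split=> [i|i j].
  have [w _ <-] := Hz; rewrite -iterD addnC iterD.
  by exists (iter i phi w).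
wlog lij : i j / (i < j)%N.
  move=> wl; have [ij|ij|/ord_inj ij _] := ltngtP i j; last by [].
    exact: wl.
  move=> e; apply/esym; apply: wl => //.
  by rewrite -[_^-1 * _]invgK invgM invgK; apply: subgV.
move=> e; case: (nEW i); rewrite -[iter i phi z]invgK.
apply: subgV => //; rewrite -[_^-1](mulgK (iter j phi z)).
apply: subgM => //; first exact: EWS e.
by apply: subgV => //; rewrite -(subnKC lij); apply: EW.
Qed.

Lemma nilpotent_quotient : exists c, lower_central G c `<=` range phi.
Proof.
pose E n := low_index G n.
have fE n : fully_invariant (E n) := low_index_fully_invariant G n.
have iE n : exists m, index_le m [set: G] (E n) := low_index_finite n gsP.
have nphiE n := image_normal phiM phi_inj phi_normal (fE n).
(* The order of [E n / phi (E n)] is at most [q] whatever [n] is, so one [F] serves every [n]. *)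
pose F := E q.
have F_cent n x g : E n x -> F g -> (phi @` E n) [~ x, g].
  move=> Ex Fg; have [m iEm] := iE n.
  have [X [p [pM _ pP p1]]] := quotient_group (nphiE n).
  (* The conjugates of [x] take at most [q] values modulo [phi (E n)], so this centraliser has index
     at most [q]. *)
  pose C := [set y | p (x ^ y) = p x].
  suff: C g by move=> Cg; apply/p1; rewrite pM morphV // Cg mulVg.
  apply: Fg.
    apply/is_subgroupP; split=> [|y z Cy Cz|y Cy]; rewrite /C /=.
    - by rewrite conjg1.
    - by rewrite conjgM morphJ // Cy -morphJ.
    - by rewrite morphJ // -Cy -morphJ // conjgK.
  have [J [f [Jq fP]]] := index_image phiM phi_inj phi_normal phi_index (fE n)
    iEm.
  exists J, (fun g => f (x ^ g^-1)); split=> // y z _ _ eyz.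
  rewrite /C /= conjgM morphJ //.
  suff -> : p (x ^ y^-1) = p (x ^ z^-1) by rewrite -morphJ // conjgKV.
  by apply/pP; apply: fP => //; apply: (normJ (fully_invariant_normal (fE n))).
have [mF iF] := iE q.
have Hdecr k : H k.+1 `<=` H k by apply: HS.
have [i0 i0P] := stabilise iF (@subsetT _ (H 0)) Hdecr.
have lc_i0 n : exists c, forall x s, E n x -> size s = c ->
    (forall y, y \in s -> H i0 y) -> (phi @` E n) (lcomm x s).
  have [m iEm] := iE n.
  have [X [p [pM _ pP p1]]] := quotient_group (nphiE n).
  pose i := maxn m i0.
  exists i.+1 => x s Ex si sH'.
  have iEi : index_le i [set: G] (E n) by apply: index_leW iEm;
    rewrite leq_maxl.
  have i0i : (i0 <= i.+1)%N by rewrite leqW // leq_maxr.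
  (* By the choice of [i0], each entry of [s] is congruent modulo [F] to an element of [H i.+1].
     Replacing it does not change the commutator modulo [phi (E n)], and then [lcomm_image]
     applies. *)
  suff [s' [s's s'H s'P]] : exists s', [/\ size s' = size s,
      forall y, y \in s' -> H i.+1 y & p (lcomm x s) = p (lcomm x s')].
    apply/p1; rewrite s'P; apply/p1.
    by apply: lcomm_image iEi _ _ Ex _ s'H => //; rewrite s's.
  have : forall x', E n x' -> p x = p x' -> exists s', [/\ size s' = size s,
      forall y, y \in s' -> H i.+1 y & p (lcomm x s) = p (lcomm x' s')].
    clear si; elim: s x Ex sH' => [|y s IHs] x Ex sH' x' Ex' exx'.
      by exists [::].
    have [z Hz Fz] : exists2 z, H i.+1 z & F (z^-1 * y).
      by apply: i0P => //; apply: sH'; rewrite inE eqxx.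
    have nE := fully_invariant_normal (fE n).
    have [] := IHs [~ x, y] _ _ [~ x', z].
    - exact: (normRl nE).
    - by move=> t ts; apply: sH'; rewrite inE ts orbT.
    - exact: (normRl nE).
    - have -> : [~ x, y] = [~ x, z^-1 * y] * [~ x, z] ^ (z^-1 * y).
        by rewrite /commg /conjg !gnorm.
      have -> : [~ x, z] ^ (z^-1 * y) = [~ x, z] * [~ [~ x, z], z^-1 * y].
        by rewrite /commg /conjg !gnorm.
      rewrite (pM [~ x, z^-1 * y]) (pM [~ x, z]) (p1 [~ x, z^-1 * y]).2 ?mul1g;
        last exact: F_cent.
      rewrite (p1 [~ [~ x, z], z^-1 * y]).2 ?mulg1;
        last by apply: F_cent => //; exact: (normRl nE).
      by rewrite !(morphR pM) exx'.
    - move=> s' [s's s'H s'P]; exists (z :: s'); split=> //=.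
      + by rewrite s's.
      + by move=> t; rewrite inE => /orP[/eqP->|/s'H].
  exact.
(* From here on [n] is fixed so that [E n] lies in [H i0]. *)
have [n in0] := H_index i0.
have [c cP] := lc_i0 n.
have EH x : E n x -> H i0 x by apply.
have [m iEm] := iE n.
have [k kP] := stabilise iEm (@subsetT _ (H 0)) Hdecr.
pose i := maxn k i0; pose d := (i - i0)%N.
have iE' : i = (i0 + d)%N by rewrite subnKC // leq_maxr.
(* Each block of [c] commutators gains one more application of [phi]: as long as [j <= d], the
   entries in [H i] are images under [iter j phi] of elements of [H i0]. *)
have lc_i j : (j <= d.+1)%N -> forall x s, E n x -> size s = (j * c)%N ->
    (forall y, y \in s -> H i y) -> (iter j phi @` E n) (lcomm x s).
  elim: j => [|j IHj] jd x s Ex ss sH'.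
    by move: ss => /size0nil ->; exists x.
  rewrite -[s](cat_take_drop (j * c)) foldl_cat.
  have [x' Ex' <-] : (iter j phi @` E n) (lcomm x (take (j * c) s)).
    apply: IHj => //; first exact: ltnW.
      by rewrite size_takel // ss mulSn leq_addl.
    by move=> y /mem_take/sH'.
  have /choice[r rP] y : exists y', y \in drop (j * c) s ->
      H i0 y' /\ iter j phi y' = y.
    have [ys|] := boolP (y \in drop (j * c) s); last by exists 1.
    have [y' _ <-] : H (j + i0)%N y.
      apply: (@HS _ i); last exact: sH' (mem_drop ys).
      by rewrite iE' addnC leq_add2l.
    by rewrite iterD; exists (iter i0 phi y') => _; split=> //; exists y'.
  have -> : drop (j * c) s = map (iter j phi) (map r (drop (j * c) s)).
    rewrite -map_comp -[LHS]map_id; apply/eq_in_map => y /rP[_ /=].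
    by move->.
  rewrite -(morph_lcomm (iterM j)).
  have [|y /mapP[t /rP[] + _ ->//]|w Ew wP] :=
    cP x' (map r (drop (j * c) s)) Ex'.
    by rewrite size_map size_drop ss mulSn addnK.
  by exists w => //; rewrite -wP iterSr.
exists (d.+1 * c)%N; apply: lower_central_lcomm => // x s sc.
have [X [p [pM _ pP p1]]] := quotient_group phi_normal.
have [_ [h _ <-] hP] : exists2 y, H i.+1 y & E n (y^-1 * iter i phi x).
  apply: kP; first by rewrite leqW // leq_maxl.
  by apply: (@HS k i); [rewrite leq_maxl|exists x].
(* [e] has the same class as [x] modulo [range phi], and [iter i phi e] lies in [E n], so [lc_i]
   applies to it. As [E n] lies in [H i0], the outcome lies in [H i.+1], and [iter i phi] is
   cancelled. *)
pose e := (phi h)^-1 * x.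
have Ee : E n (iter i phi e).
  by rewrite /e iterM (morphV (iterM i)) -iterSr.
have : (iter d.+1 phi @` E n) (iter i phi (lcomm e s)).
  rewrite (morph_lcomm (iterM i)); apply: lc_i => //; first by rewrite size_map.
  by move=> _ /mapP[y _ ->]; exists y.
move=> [_ /EH[w _ <-]]; rewrite -iterD addSn addnC -iE' iterSr.
move=> /iter_inj ew; apply/p1.
have -> : p (lcomm x s) = p (lcomm e s).
  rewrite !(morph_lcomm pM); congr (lcomm _ _).
  apply/pP; rewrite -[_ * e]/((phi h)^-1 ^ x).
  by apply: (normJ phi_normal); exists h^-1; rewrite ?morphV.
by apply/p1; rewrite -ew; exists w.
Qed.

End NilpotentQuotient.

(** * Lower central series and torsion in central quotients *)

Arguments lower_central : simpl never.

Lemma generated_subgroup (G : groupType) (S : set G) :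
  is_subgroup (generated S).
Proof.
apply/is_subgroupP; split=> [A [sA _]|x y Sx Sy A [sA SA]|x Sx A [sA SA]].
- exact: subg1.
- by apply: subgM => //; [apply: Sx|apply: Sy].
- by apply: subgV => //; apply: Sx.
Qed.

Section LowerCentral.
Context {G : groupType}.

Lemma lower_central_subgroup n : is_subgroup (lower_central G n).
Proof. by case: n => [|n];
  [exact: subgroup_setT|exact: generated_subgroup]. Qed.

Lemma lower_centralR n x y :
  lower_central G n x -> lower_central G n.+1 [~ x, y].
Proof. by move=> nx A [_]; apply; exists x => //; exists y. Qed.

Lemma lower_central_ind n (A : set G) : is_subgroup A ->
  (forall x y, lower_central G n x -> A [~ x,
    y]) -> lower_central G n.+1 `<=` A.
Proof.
by move=> sA AP; apply: generated_sub => // _ [x nx [y _ <-]]; apply: AP.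
Qed.

End LowerCentral.

Lemma morph_lower_central (G X : groupType) (f : G -> X) :
  {morph f : x y / x * y} ->
  forall n x, lower_central G n x -> lower_central X n (f x).
Proof.
move=> fM; elim=> // n IHn; apply: lower_central_ind.
  exact/preimage_subgroup/lower_central_subgroup.
by move=> x y nx /=; rewrite morphR //; apply: lower_centralR; apply: IHn.
Qed.

Lemma lower_central_surj (G X : groupType) (f : G -> X) :
  {morph f : x y / x * y} -> (forall z, exists x, f x = z) ->
  forall n, lower_central X n `<=` f @` lower_central G n.
Proof.
move=> fM fS; elim=> [z _|n IHn]; first by have [x <-] := fS z; exists x.
apply: lower_central_ind.
  exact/image_subgroup/lower_central_subgroup.
move=> _ z /IHn[x nx <-]; have [y <-] := fS z.
by exists [~ x, y]; [exact: lower_centralR|rewrite morphR].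
Qed.

Section LowerCentralInvariant.
Context {G : groupType}.

Lemma lower_central_invariant n : fully_invariant (lower_central G n).
Proof.
split; first exact: lower_central_subgroup.
by move=> f fM x; apply: morph_lower_central.
Qed.

Lemma lower_central_normal n : normal_subgroup (lower_central G n).
Proof. exact/fully_invariant_normal/lower_central_invariant. Qed.

Lemma lower_central_sub m n : (m <= n)%N ->
  lower_central G n `<=` lower_central G m.
Proof.
move/subnKC <-; elim: (n - m)%N => [|k IHk]; first by rewrite addn0.
rewrite addnS; apply: lower_central_ind; first exact: lower_central_subgroup.
by move=> x y /IHk; apply: normRl; apply: lower_central_normal.
Qed.

End LowerCentralInvariant.

Definition torsion_mod (G : groupType) (B K : set G) : set G :=
  [set x | B x /\ exists2 m, (0 < m)%N & K (x ^+ m)].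

Definition spans_mod (G : groupType) (B K : set G) (s : seq G) : Prop :=
  (forall x, x \in s -> B x) /\
  forall A, is_subgroup A -> K `<=` A -> (forall x, x \in s -> A x) -> B `<=` A.

(* [B / K] is a central subgroup of [G / K]. *)
Definition central_mod (G : groupType) (B K : set G) : Prop :=
  [/\ is_subgroup B, is_subgroup K, K `<=` B & forall x y, B x -> K [~ x, y]].

Section CentralMod.
Context {G : groupType} {B K : set G}.
Hypothesis cBK : central_mod B K.

Lemma central_mod_normal : normal_subgroup K.
Proof.
have [_ sK KB cK] := cBK; split=> // x y Kx.
have -> : x ^ y = x * [~ x, y] by rewrite /commg mulVKg.
by apply: subgM => //; apply/cK/KB.
Qed.

Lemma torsion_mod_subgroup : is_subgroup (torsion_mod B K).
Proof.
have [sB sK KB cK] := cBK.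
have [X [p [pM _ pP p1]]] := quotient_group central_mod_normal.
have pC x y : B x -> commute (p x) (p y).
  move=> Bx; apply/commgP/eqP; rewrite -morphR //; apply/p1; exact: cK.
apply/is_subgroupP; split.
- by split; [exact: subg1|exists 1%N => //; rewrite expg1n; exact: subg1].
- move=> x y [Bx [m m0 /p1 xm]] [By [n n0 /p1 yn]].
  rewrite !(morphX pM) in xm yn.
  split; first exact: subgM.
  exists (m * n)%N; rewrite ?muln_gt0 ?m0 //; apply/p1.
  rewrite (morphX pM) pM expgMn; last exact: pC.
  by rewrite expgnA xm expg1n mul1g mulnC expgnA yn expg1n.
- move=> x [Bx [m m0 Kx]]; split; first exact: subgV.
  by exists m => //; rewrite expVgn; apply: subgV.
Qed.

End CentralMod.

(* The subgroup [K <a>]; two natural exponents stand for an integer one. *)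
Definition adjoin (G : groupType) (K : set G) (a : G) : set G :=
  [set x | exists i j, K ((a ^+ j)^-1 * (x * a ^+ i))].

Section Adjoin.
Context {G : groupType} {B K : set G} {a : G}.
Hypothesis cBK : central_mod B K.
Hypothesis Ba : B a.

Lemma adjoin_sub : K `<=` adjoin K a.
Proof. by move=> x Kx; exists 0%N, 0%N; rewrite invg1 mulg1 mul1g. Qed.

Lemma adjoin_mem : adjoin K a a.
Proof.
by exists 0%N, 1%N; rewrite mulg1 mulVg; case: cBK => _ sK _ _; apply: subg1.
Qed.

Lemma adjoin_central : central_mod B (adjoin K a).
Proof.
have [sB sK KB cK] := cBK.
have [X [p [pM _ pP _]]] := quotient_group (central_mod_normal cBK).
have pC x n : commute (p x) (p a ^+ n).
  apply/commute_sym/commgP/eqP; rewrite -(morphX pM) -morphR //.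
  by rewrite -(morph1 pM); apply/esym/pP; rewrite invg1 mul1g; apply/cK/subgX.
have adP x : adjoin K a x <-> exists i j, p x * p a ^+ i = p a ^+ j.
  split=> -[i [j xij]]; exists i, j; first by apply/esym;
    rewrite -!(morphX pM) -pM; apply/pP.
  by apply/pP; rewrite pM !(morphX pM) xij.
split=> //.
- apply/is_subgroupP; split=> [|x y /adP[i [j xij]] /adP[k [l ykl]]|x /adP[i [j
  xij]]].
  + exact/adjoin_sub/subg1.
  + apply/adP; exists (k + i)%N, (j + l)%N.
    by rewrite pM expgnDr mulgA -(mulgA (p x)) ykl -mulgA -expgnDr addnC
      expgnDr mulgA xij -expgnDr.
  + apply/adP; exists j, i; rewrite morphV //.
    by apply: (@mulgI _ (p x)); rewrite mulVKg.
- move=> x [i [j /KB Bx]];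
  have := subgM sB (subgM sB (subgX sB j Ba) Bx) (subgV sB (subgX sB i Ba)).
  by rewrite mulVKg mulgK.
- by move=> x y Bx; apply/adjoin_sub/cK.
Qed.

Lemma spans_mod_adjoin s : spans_mod B K (a :: s) -> spans_mod B (adjoin K a) s.
Proof.
move=> [sB' sP]; split=> [x xs|A sA aA sA']; first by apply: sB';
  rewrite inE xs orbT.
apply: sP => // [x Kx|x]; first exact/aA/adjoin_sub.
by rewrite inE => /orP[/eqP->|]; [apply/aA/adjoin_mem|apply: sA'].
Qed.

End Adjoin.

(** Induction on the generators, adjoining [a] to [K]. If [a] is torsion modulo [K], then
    [K <a> / K] is finite; otherwise it is torsion-free and the torsion of [B / K] embeds in
    [B / K <a>]. *)
Lemma torsion_mod_finite (G : groupType) (s : seq G) (B K : set G) :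
  central_mod B K -> spans_mod B K s ->
  exists n, index_le n (torsion_mod B K) K.
Proof.
elim: s K => [|a s IHs] K cBK ss.
  have [sB sK KB cK] := cBK.
  have BK : B `<=` K by apply: ss.2.
  exists 1%N, unit, (fun=> tt); split=> [|x y [/BK Kx _] [/BK Ky _] _].
    by rewrite card_unit.
  by apply: subgM => //; apply: subgV.
have Ba : B a by apply: ss.1; rewrite inE eqxx.
have [sB sK KB cK] := cBK.
have cBK' := adjoin_central cBK Ba; have [_ sK' _ _] := cBK'.
have [n iK'] := IHs _ cBK' (spans_mod_adjoin cBK ss).
have {}iK' : index_le n (torsion_mod B K) (adjoin K a).
  apply: index_leS iK' => x [Bx [m m0 Kx]]; split=> //; exists m => //.
  exact: adjoin_sub.
have [X [p [pM _ pP p1]]] := quotient_group (central_mod_normal cBK).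
have pC x n' : commute (p x) (p a ^+ n').
  apply/commute_sym/commgP/eqP; rewrite -(morphX pM) -morphR //.
  exact/p1/cK/subgX.
have adP x : adjoin K a x -> exists ij, p x * p a ^+ ij.1 = p a ^+ ij.2.
  by move=> [i [j xij]]; exists (i, j) => /=; apply/esym;
    rewrite -!(morphX pM) -pM; apply/pP.
have [[m m0 am]|ntor] := pselect (exists2 m, (0 < m)%N & K (a ^+ m)).
  have {}am : p a ^+ m = 1 by rewrite -(morphX pM); apply/p1.
  have mod_m i : p a ^+ i = p a ^+ (i %% m).
    by rewrite {1}(divn_eq i m) expgnDr mulnC expgnA am expg1n mul1g.
  have /choice[r rP] x : exists ij : nat * nat,
      adjoin K a x -> p x * p a ^+ ij.1 = p a ^+ ij.2.
    have [/adP[ij xij]|] := pselect (adjoin K a x); last by exists (0%N, 0%N).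
    by exists ij.
  exists (n * (m * m))%N; apply: (index_le_trans sK' iK').
  pose md i : 'I_m := Ordinal (ltn_pmod i m0).
  exists ('I_m * 'I_m)%type, (fun x => (md (r x).1, md (r x).2)).
  split=> [|x y /rP xr /rP yr [e1 e2]]; first by rewrite card_prod card_ord.
  apply/pP; apply: (@mulIg _ (p a ^+ (r x).1)); rewrite xr.
  by rewrite mod_m e2 -mod_m -yr mod_m -e1 -mod_m.
have a_inj i j : p a ^+ i = p a ^+ j -> i = j.
  wlog ij : i j / (i <= j)%N.
    by move=> wl; case/orP: (leq_total i j) => [/wl//|/wl H /esym/H].
  rewrite -(subnKC ij) expgnDr => e.
  have : p a ^+ (j - i) = 1 by apply: (@mulgI _ (p a ^+ i)); rewrite mulg1.
  case: (j - i)%N => [|k] ek; first by rewrite addn0.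
  by case: ntor; exists k.+1 => //; apply/p1; rewrite morphX.
exists n; have [I [f [In fP]]] := iK'; exists I, f; split=> // x y tx ty exy.
have sT := torsion_mod_subgroup cBK.
have [ij] := adP _ (fP _ _ tx ty exy).
have [_ [m m0 /p1]] : torsion_mod B K (x^-1 * y) by apply: subgM => //;
  apply: subgV.
rewrite (morphX pM); set z := p _ => zm zij.
apply/p1; rewrite -/z; apply: (@mulIg _ (p a ^+ ij.1)); rewrite mul1g zij.
have /eqP : (ij.1 * m = ij.2 * m)%N.
  by apply: a_inj; rewrite !expgnA -zij expgMn ?zm ?mul1g //; apply: pC.
by rewrite eqn_pmul2r // => /eqP->.
Qed.

Lemma torsion_mod_exponent (G : groupType) (s : seq G) (B K : set G) :
  central_mod B K -> spans_mod B K s ->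
  exists2 t, (0 < t)%N & forall x, torsion_mod B K x -> K (x ^+ t).
Proof.
move=> cBK ss; have [n iK] := torsion_mod_finite cBK ss.
exists n`!; first exact: fact_gt0.
move=> x /(index_le_expg (torsion_mod_subgroup cBK) iK)[m [m0 mn Kxm]].
have /dvdnP[k ->] : (m %| n`!)%N by rewrite dvdn_fact // m0.
by rewrite mulnC expgnA; apply: subgX => //; case: cBK.
Qed.

(** In a finitely generated abelian group an element with [n]-th roots for all [n] is torsion. By
    induction a power of [x] lies in [K <a>], and roots of large order force it into [K]. *)
Lemma divisible_torsion (G : groupType) (s : seq G) (K : set G) (x : G) :
  central_mod [set: G] K -> spans_mod [set: G] K s ->
  (forall n, (0 < n)%N -> exists g, K ((g ^+ n)^-1 * x)) ->
  exists2 m, (0 < m)%N & K (x ^+ m).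
Proof.
elim: s K => [|a s IHs] K cBK ss xP.
  by exists 1%N => //; apply: ss.2 => //; case: cBK.
have [sB sK KB cK] := cBK.
have cBK' := adjoin_central cBK (I : [set: G] a); have [_ sK' _ _] := cBK'.
have ss' := spans_mod_adjoin cBK ss.
have [|m m0 xm] := IHs _ cBK' ss'.
  by move=> n /xP[g Kg]; exists g; apply: adjoin_sub.
have [X [p [pM _ pP p1]]] := quotient_group (central_mod_normal cBK).
have pC x' y : commute (p x') (p y).
  by apply/commgP/eqP; rewrite -morphR //; apply/p1/cK.
have adP y : adjoin K a y <-> exists ij, p y * p a ^+ ij.1 = p a ^+ ij.2.
  split=> [[i [j xij]]|[[i j] xij]].
    by exists (i, j) => /=; apply/esym; rewrite -!(morphX pM) -pM; apply/pP.
  by exists i, j; apply/pP; rewrite pM !(morphX pM) xij.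
have [[i j] /=] := (adP _).1 xm; rewrite (morphX pM) => xij.
have [[t t0 /p1 at1]|ntor] := pselect (exists2 t, (0 < t)%N & K (a ^+ t)).
  exists (m * t)%N; first by rewrite muln_gt0 m0.
  have {}at1 : p a ^+ t = 1 by rewrite -(morphX pM).
  have : p x ^+ m ^+ t * p a ^+ i ^+ t = p a ^+ j ^+ t.
    by rewrite -xij expgMn //; apply: commuteX2; apply: pC.
  rewrite -!(expgnA (p a)) !(mulnC _ t) !expgnA at1 !expg1n mulg1 => H.
  by apply/p1; rewrite !(morphX pM) expgnAC.
have a_inj k l : p a ^+ k = p a ^+ l -> k = l.
  wlog kl : k l / (k <= l)%N.
    by move=> wl; case/orP: (leq_total k l) => [/wl//|/wl H /esym/H].
  rewrite -(subnKC kl) expgnDr => e.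
  have : p a ^+ (l - k) = 1 by apply: (@mulgI _ (p a ^+ k)); rewrite mulg1.
  case: (l - k)%N => [|n] en; first by rewrite addn0.
  by case: ntor; exists n.+1 => //; apply/p1; rewrite morphX.
have [t t0 tP] := torsion_mod_exponent cBK' ss'.
(* [n] exceeds both exponents, so that [i = j] modulo [n] gives [i = j]. The factor [t] in the root
   order brings a power of the root into [K <a>]. *)
pose n := (i + j).+1.
have [|g /pP] := xP (t * n)%N; first by rewrite muln_gt0 t0.
rewrite (morphX pM) => gx.
have {}gx : p x ^+ m = (p g ^+ m) ^+ (t * n) by rewrite -gx expgnAC.
have [k [l /pP]] : adjoin K a ((g ^+ m) ^+ t).
  apply: tP; split=> //; exists (t * n)%N; rewrite ?muln_gt0 ?t0 //; apply/adP;
    exists (i, j) => /=.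
  by rewrite !(morphX pM) -gx.
rewrite pM !(morphX pM) => gkl.
have {}gkl : p x ^+ m * p a ^+ (k * n) = p a ^+ (l * n).
  rewrite gx !expgnA gkl expgMn //.
  by apply: commuteX2; rewrite -(morphX pM); apply: pC.
have jkli : (j + k * n = l * n + i)%N.
  by apply: a_inj; rewrite !expgnDr -xij -gkl -!mulgA; congr (_ * _);
    rewrite -!expgnDr addnC.
have ij : i = j.
  have : (i = j %[mod n])%N by rewrite -(modnMDl l i) -jkli addnC modnMDl.
  by rewrite !modn_small // ltnS ?leq_addl ?leq_addr.
exists m => //; apply/p1; rewrite (morphX pM); apply: (@mulIg _ (p a ^+ i)).
by rewrite xij ij mul1g.
Qed.

Lemma central_mod_lower_central (G : groupType) n :
  central_mod (lower_central G n) (lower_central G n.+1).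
Proof.
split; do ?exact: lower_central_subgroup.
- exact: lower_central_sub.
- by move=> x y; apply: lower_centralR.
Qed.

Lemma spans_mod_setT (G : groupType) (s : seq G) (K : set G) :
  spans s -> spans_mod [set: G] K s.
Proof. by move=> ss; split=> // A sA _ sA' x _; apply: ss. Qed.

(** * Commutator calculus in nilpotency class two *)

Section Class2.
Context {X : groupType}.
Hypothesis class2 : forall x y z : X, [~ [~ x, y], z] = 1.

Lemma commg_central (x y z : X) : commute [~ x, y] z.
Proof. by apply/commgP/eqP. Qed.

Lemma commgMl x y z : [~ x * y, z] = [~ x, z] * [~ y, z] :> X.
Proof.
have -> : [~ x * y, z] = [~ x, z] ^ y * [~ y,
  z] by rewrite /commg /conjg !gnorm.
by rewrite (conjgE [~ x, z]) (commg_central x z y) mulKg.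
Qed.

Lemma commgMr x y z : [~ x, y * z] = [~ x, y] * [~ x, z] :> X.
Proof. by rewrite -invgR commgMl invgM !invgR; apply: commg_central. Qed.

Lemma commgXl x y n : [~ x ^+ n, y] = [~ x, y] ^+ n :> X.
Proof. by elim: n => [|n IHn]; rewrite ?comm1g // !expgS commgMl IHn. Qed.

Lemma commgXr x y n : [~ x, y ^+ n] = [~ x, y] ^+ n :> X.
Proof. by rewrite -invgR commgXl -expVgn invgR. Qed.

Lemma commgVr x y : [~ x, y^-1] = [~ x, y]^-1 :> X.
Proof. by apply: (@mulgI _ [~ x, y]); rewrite -commgMr !mulgV commg1. Qed.

Lemma commgVl x y : [~ x^-1, y] = [~ x, y]^-1 :> X.
Proof. by rewrite -invgR commgVr invgR. Qed.

Lemma lower_central2 : lower_central X 2 `<=` [set 1].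
Proof.
have s1 : is_subgroup [set (1 : X)].
  by apply/is_subgroupP; split=> [|x y -> ->|x ->] /=; rewrite ?mulg1 ?invg1.
apply: lower_central_ind => // x y.
suff : lower_central X 1 `<=` [set x | forall y, [~ x, y] = 1] by move=> H /H;
  apply.
apply: lower_central_ind => [|u v _ z]; last exact: class2.
apply/is_subgroupP; split=> [z|u v eu ev z|u eu z].
- by rewrite comm1g.
- by rewrite commgMl eu ev mulg1.
- by rewrite commgVl eu invg1.
Qed.

Lemma lower_central1_central x y : lower_central X 1 x -> commute x y.
Proof.
move=> x1; apply/commgP/eqP; apply: lower_central2.
exact: lower_centralR.
Qed.

End Class2.

(** Commutators are central modulo the third term, so the bracket is bilinear there and is
    determined by the generators. *)
Lemma spans_mod_commg (G : groupType) (s : seq G) : spans s ->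
  spans_mod (lower_central G 1) (lower_central G 2) [seq [~ x, y] | x <- s,
    y <- s].
Proof.
move=> ss; split=> [_ /allpairsP[[x y] [_ _ ->]]|A sA A2 sP];
  first exact: lower_centralR.
have AJ x y z : A [~ x, y] -> A ([~ x, y] ^ z).
  have -> : [~ x, y] ^ z = [~ x, y] * [~ [~ x, y], z] by rewrite [[~ [~ _, _],
    _]]commgEl mulVKg.
  move=> Axy; apply: subgM => //; apply: A2.
  by do 2!apply: lower_centralR.
have As y : y \in s -> forall x, A [~ x, y].
  move=> ys x; apply: (ss [set x | A [~ x, y]]) => [|z zs]; last first.
    by apply: sP; apply/allpairsP; exists (z, y).
  apply/is_subgroupP; split=> [|u v Au Av|u Au] /=.
  - by rewrite comm1g; apply: subg1.
  - have -> : [~ u * v, y] = [~ u, y] ^ v * [~ v,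
    y] by rewrite /commg /conjg !gnorm.
    by apply: subgM => //; apply: AJ.
  - have -> : [~ u^-1, y] = ([~ u,
    y] ^ u^-1)^-1 by rewrite /commg /conjg !gnorm.
    by apply: subgV => //; apply: AJ.
apply: lower_central_ind => // x y _.
apply: (ss [set y | A [~ x, y]]) => [|z zs]; last exact: As.
apply/is_subgroupP; split=> [|u v Au Av|u Au] /=.
- by rewrite commg1; apply: subg1.
- have -> : [~ x, u * v] = [~ x, v] * [~ x,
  u] ^ v by rewrite /commg /conjg !gnorm.
  by apply: subgM => //; apply: AJ.
- have -> : [~ x, u^-1] = ([~ x, u] ^ u^-1)^-1 by rewrite /commg /conjg !gnorm.
  by apply: subgV => //; apply: AJ.
Qed.

(* Let [u] record the values on the list [l] of a homomorphism from [X] to its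
   central derived subgroup.  If a positive multiple of it is the bracket with
   an element of [Z], then so is its [r]-th multiple: the quotient of the group
   of all homomorphisms by these brackets is a finitely generated abelian group,
   so its torsion has bounded exponent. *)
Lemma uniform_commg_root (X : groupType) (s : seq X) :
  (forall x y z : X, [~ [~ x, y], z] = 1) -> spans s ->
  forall (l : seq X) (Z : set X), is_subgroup Z ->
  exists2 r, (0 < r)%N & forall u : X -> X,
    (forall x, x \in l -> lower_central X 1 (u x)) ->
    (exists2 q, (0 < q)%N & exists2 w, Z w &
       forall x, x \in l -> u x ^+ q = [~ x, w]) ->
    exists2 z, Z z & forall x, x \in l -> u x ^+ r = [~ x, z].
Proof.
move=> cl2 ss; elim=> [|a l IHl] Z sZ.
  by exists 1%N => // u _ _; exists 1; [exact: subg1|].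
pose K := [set [~ a, z] | z in Z].
have sK : is_subgroup K.
  apply/is_subgroupP; split.
  - by exists 1; [exact: subg1|rewrite commg1].
  - move=> _ _ [x Zx <-] [y Zy <-]; exists (x * y); first exact: subgM.
    by rewrite commgMr.
  - by move=> _ [x Zx <-]; exists x^-1; [exact: subgV|rewrite commgVr].
have cK : central_mod (lower_central X 1) K.
  split=> //; first exact: lower_central_subgroup.
  - by move=> _ [z _ <-]; apply: lower_centralR.
  - move=> x y /(lower_centralR y)/(lower_central2 cl2) ->; exact: (subg1 sK).
have [gB sB] := spans_mod_commg ss.
have [|t t0 tP] := torsion_mod_exponent cK (s :=
  [seq [~ x, y] | x <- s, y <- s]).
  by split=> // A sA KA; apply: sB => // x /(lower_central2 cl2) ->;
    apply: (subg1 sA).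
(* Corrections made for the rest of the list are taken in the centraliser of [a], so as not to
   disturb the value at [a]. *)
pose Z' := Z `&` [set z | [~ a, z] = 1].
have sZ' : is_subgroup Z'.
  apply/is_subgroupP; split=> [|x y [Zx ax] [Zy ay]|x [Zx ax]].
  - by split; [exact: subg1|rewrite /= commg1].
  - by split; [exact: subgM|rewrite /= commgMr // ax ay mulg1].
  - by split; [exact: subgV|rewrite /= commgVr // ax invg1].
have [r r0 rP] := IHl _ sZ'.
exists (t * r)%N; first by rewrite muln_gt0 t0.
move=> u ul [q q0 [w Zw uw]].
have al : a \in a :: l by rewrite inE eqxx.
have lal x : x \in l -> x \in a :: l by rewrite inE orbC => ->.
have [z1 Zz1 az1] : K (u a ^+ t).
  by apply: tP; split; [exact: ul|exists q => //; rewrite uw //; exists w].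
pose v x := u x ^+ t * [~ x, z1]^-1.
have vX x n : v x ^+ n = u x ^+ t ^+ n * [~ x, z1]^-1 ^+ n.
  by apply: expgMn; apply/commute_sym; rewrite invgR; apply: commg_central.
have [||z2 [Zz2 az2] z2P] := rP v.
- move=> x /lal xl; apply: (subgM (lower_central_subgroup 1)).
    by apply: (subgX (lower_central_subgroup 1)); apply: ul.
  by rewrite invgR; apply: lower_centralR.
- have vq x : x \in a :: l -> v x ^+ q = [~ x, w ^+ t * z1^-1 ^+ q].
    by move=> xl; rewrite vX expgnAC uw // commgMr // !commgXr // commgVr.
  exists q => //; exists (w ^+ t * z1^-1 ^+ q); last by move=> x /lal/vq.
  split; first by apply: subgM => //; apply: subgX => //; apply: subgV.
  by rewrite /= -vq // /v az1 mulgV expg1n.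
exists (z1 ^+ r * z2); first by apply: subgM => //; apply: subgX.
move=> x; rewrite inE commgMr // commgXr // expgnA => /orP[/eqP->|xl].
  by rewrite az2 mulg1 az1.
rewrite -z2P // vX expVgn mulgA.
have -> : [~ x, z1] ^+ r * u x ^+ t ^+ r = u x ^+ t ^+ r * [~ x, z1] ^+ r.
  exact/commute_sym/commuteX/commute_sym/commg_central.
by rewrite mulgK.
Qed.

(** * The isolator of the derived subgroup *)

Lemma set_product_normal (G : groupType) (H K : set G) :
  normal_subgroup H -> normal_subgroup K -> normal_subgroup (set_product H K).
Proof.
move=> nH nK; have [sH _] := nH; have [sK _] := nK.
split; last first.
  move=> _ y [h Hh [k Kk <-]]; exists (h ^ y); first exact: (normJ nH).
  by exists (k ^ y); [exact: (normJ nK)|rewrite conjMg].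
apply/is_subgroupP; split.
- by exists 1; [exact: (subg1 sH)|exists 1; [exact: (subg1 sK)|rewrite mulg1]].
- move=> _ _ [h Hh [k Kk <-]] [h' Hh' [k' Kk' <-]].
  exists (h * h'); first exact: (subgM sH).
  exists (k ^ h' * k'); first by apply: (subgM sK) => //; apply: (normJ nK).
  by rewrite /conjg !gnorm.
- move=> _ [h Hh [k Kk <-]]; exists h^-1; first exact: (subgV sH).
  exists (k^-1 ^ h^-1); first by apply/(normJ nK)/(subgV sK).
  by rewrite /conjg !gnorm.
Qed.

Section Isolator.
Context {G : groupType} {gs : seq G}.
Hypothesis gsP : spans gs.

Let B := lower_central G 1.
Let C := lower_central G 2.
Let tau := torsion_mod [set: G] B.
Let cB : central_mod [set: G] B := central_mod_lower_central G 0.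
Let cC : central_mod B C := central_mod_lower_central G 1.

Let sB : is_subgroup B := lower_central_subgroup 1.
Let sC : is_subgroup C := lower_central_subgroup 2.
Let stau : is_subgroup tau := torsion_mod_subgroup cB.

Lemma isolator_invariant : fully_invariant tau.
Proof.
split=> // f fM x [_ [m m0 xm]]; split=> //; exists m => //.
by rewrite -(morphX fM); apply: morph_lower_central.
Qed.

Section Endo.
Context {phi : G -> G} {q : nat}.
Hypothesis phiM : {morph phi : x y / x * y}.
Hypothesis phi_inj : injective phi.
Hypothesis phi_normal : normal_subgroup (range phi).
Hypothesis phi_index : index_le q [set: G] (range phi).

(** For each [n], the subgroup [E] of [n]-th powers modulo [B] is fully invariant of finite index,
    so [E / phi E] has at most [q] elements and [y ^+ q!] lies in [E]. Being divisible modulo [B] by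
    every [n], it is torsion there. *)
Lemma isolator_preimage y : B (phi y) -> tau y.
Proof.
move=> By; suff [m m0 Bm] : exists2 m, (0 < m)%N & B ((y ^+ q`!) ^+ m).
  split=> //; exists (q`! * m)%N; last by rewrite expgnA.
  by rewrite muln_gt0 fact_gt0.
apply: (divisible_torsion cB (spans_mod_setT _ gsP)) => n n0.
pose E : set G := [set x | exists g, B ((g ^+ n)^-1 * x)].
have [A [p [pM pS pP p1]]] := quotient_group (central_mod_normal cB).
have pC x x' : commute (p x) (p x').
  by apply/commgP/eqP; rewrite -(morphR pM); apply/p1;
    apply: (@lower_centralR _ 0).
have EP x : E x <-> exists g, p x = p g ^+ n.
  split=> -[g]; exists g; first by rewrite -(morphX pM); apply/esym/pP.
  by apply/pP; rewrite (morphX pM).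
have fE : fully_invariant E.
  split; last first.
    move=> f fM x [g Bg]; exists (f g).
    by rewrite -(morphX fM) -(morphV fM) -fM; apply: morph_lower_central.
  apply/is_subgroupP; split=> [|x x' /EP[g xg] /EP[g' xg']|x /EP[g xg]];
    apply/EP.
  - by exists 1; rewrite (morph1 pM) expg1n.
  - exists (g * g'); rewrite !pM expgMn; last exact: pC.
    by rewrite xg xg'.
  - by exists g^-1; rewrite !(morphV pM) xg expVgn.
have cE : central_mod [set: G] E.
  split=> [||//|x x' _]; [exact: subgroup_setT|by case: fE|].
  exists 1; rewrite expg1n invg1 mul1g; exact: (@lower_centralR _ 0).
have [m iE] := torsion_mod_finite cE (spans_mod_setT _ gsP).
have {}iE : index_le m [set: G] E.
  apply: index_leS iE => x _; split=> //; exists n => //; exists x.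
  by rewrite mulVg; apply: (subg1 sB).
have EB : E (phi y) by exists 1; rewrite expg1n invg1 mul1g.
have sE : is_subgroup E by case: fE.
have [k [k0 kq]] := index_le_expg sE (index_image phiM phi_inj phi_normal
  phi_index fE iE) EB.
rewrite -(morphX phiM) => -[_ /[swap] /phi_inj -> Ek].
have /dvdnP[j ->] : (k %| q`!)%N by rewrite dvdn_fact // k0.
by rewrite mulnC expgnA; apply: (subgX sE).
Qed.

Lemma commg_isolator y g : exists2 d, tau d & phi d = [~ phi y, g].
Proof.
have [d _ dP] : range phi [~ phi y, g] by apply: (normRl phi_normal); exists y.
exists d => //; apply: isolator_preimage; rewrite dP;
  exact: (@lower_centralR _ 0).
Qed.

(* Conjugation by [g] on [range phi] is trivial modulo [phi @` tau], so modulo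
   [phi @` W] it is determined by one element of [tau / W] per generator. *)
Lemma low_index_centralise (W : set G) n : fully_invariant W ->
  index_le n tau W -> forall y g, low_index G (n ^ size gs) g ->
  (phi @` W) [~ phi y, g].
Proof.
move=> fW [I [f [In fP]]] y g Fg.
have nphiW := image_normal phiM phi_inj phi_normal fW.
have [X [p [pM pS pP p1]]] := quotient_group nphiW.
pose D := [set g | forall y, commute (p (phi y)) (p g)].
suff: D g by move=> /(_ y)/commgP/eqP; rewrite -(morphR pM) => /p1.
apply: Fg.
  apply/is_subgroupP; split=> [z|a b Da Db z|a Da z].
  - by rewrite (morph1 pM); apply: commute1.
  - by rewrite pM; apply: commuteM.
  - by rewrite (morphV pM); apply: commuteV.
have /choice[d dP] (yg : G * G) : exists d, tau d /\ phi d = [~ phi yg.1, yg.2].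
  by have [d td dP] := commg_isolator yg.1 yg.2; exists d.
exists {ffun 'I_(size gs) -> I}.
exists (fun g => [ffun i : 'I_(size gs) => f (d (nth 1 gs i, g^-1))]); split.
  by rewrite card_ffun card_ord; case: (size gs) => // k; rewrite leq_exp2r.
move=> a b _ _ /ffunP eab.
suff Ds x : x \in gs -> commute (p (phi x)) (p (a^-1 * b)).
  move=> x; apply: (gsP (A := [set x | commute (p (phi x)) (p (a^-1 * b))])) =>
    //.
  apply/is_subgroupP; split=> [|u v Du Dv|u Du]; apply/commute_sym.
  - by rewrite (morph1 phiM) (morph1 pM); apply: commute1.
  - by rewrite phiM pM; apply: commuteM; apply/commute_sym.
  - by rewrite (morphV phiM) (morphV pM); apply/commuteV/commute_sym.
move=> /(nthP 1)[i si <-]; have := eab (Ordinal si); rewrite !ffunE /=.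
set z := nth 1 gs i => e.
have [ta /= da] := dP (z, a^-1); have [tb /= db] := dP (z, b^-1).
have : p (phi z ^ a^-1) = p (phi z ^ b^-1).
  have H w : phi z ^ w = phi z * [~ phi z, w] by rewrite commgEl mulVKg.
  rewrite !H !(pM (phi z)) -da -db; congr (_ * _); apply/pP.
  by rewrite -(morphV phiM) -phiM;
    exists ((d (z, a^-1))^-1 * d (z, b^-1)) => //; apply: fP.
rewrite !(morphJ pM) => eJ; apply/commgP;
  rewrite -conjg_fix pM !(morphV pM) conjgM.
rewrite -(morphV pM) eJ (morphV pM) conjgKV; exact/eqP.
Qed.

End Endo.

(** Modulo [C] the bracket is bilinear, so [[d, y] ^+ m] is congruent to [[d ^+ m, y]], which lies
    in [C] when [d ^+ m] is in [B]. *)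
Lemma isolator_commg d y : tau d -> torsion_mod B C [~ d, y].
Proof.
move=> [_ [m m0 Bm]]; split; first exact: (@lower_centralR _ 0).
exists m => //.
have [X [p [pM pS pP p1]]] := quotient_group (lower_central_normal (G := G) 2).
have cl2 x1 x2 x3 : [~ [~ x1, x2], x3] = 1 :> X.
  have [[[a <-] [b <-]] [c <-]] := (pS x1, pS x2, pS x3).
  by rewrite -!(morphR pM); apply/p1; do 2!apply: lower_centralR.
apply/p1; rewrite (morphX pM) (morphR pM) -(commgXl cl2) -(morphX pM) -(morphR
  pM).
by apply/p1; apply: (@lower_centralR _ 1).
Qed.

(* Modulo [T] the group has class 2, its derived subgroup is torsion-free and
   [tau] is central.  For [x] in [G] let [sg] be the automorphism of [G] that
   conjugation by [x] induces through [phi]; the [t]-th power of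
   [y |-> y^-1 * sg y] takes values in the derived subgroup, and a power of it
   is a bracket since [x ^+ Q] lies in [range phi].  By [uniform_commg_root],
   [x ^+ (t * r)] therefore agrees with an element of [range phi] up to an
   element [v] centralising [range phi], hence [G], modulo [T]. *)
Lemma exponent_bound : exists2 e, (0 < e)%N & forall (phi : G -> G) q,
  {morph phi : x y / x * y} -> injective phi -> normal_subgroup (range phi) ->
  index_le q [set: G] (range phi) ->
  forall x, B x -> set_product C (range phi) (x ^+ e).
Proof.
have [t t0 tP] := torsion_mod_exponent cB (spans_mod_setT _ gsP).
have [t' t'0 t'P] := torsion_mod_exponent cC (spans_mod_commg gsP).
pose T := torsion_mod B C.
have sT : is_subgroup T := torsion_mod_subgroup cC.
have CT : C `<=` T.
  by move=> x Cx; split; [exact: (lower_central_sub (leqnSn 1))|exists 1%N].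
have iT : fully_invariant T.
  split=> // f fM x [Bx [m m0 Cm]]; split; first exact: morph_lower_central.
  by exists m => //; rewrite -(morphX fM); apply: morph_lower_central.
have [X [p [pM pS pP p1]]] := quotient_group (fully_invariant_normal iT).
have pf f (fM : {morph f : x y / x * y}) a b : p a = p b -> p (f a) = p (f b).
  by move=> /pP Tab; apply/pP; rewrite -(morphV fM) -fM; apply: iT.2.
have cl2 x1 x2 x3 : [~ [~ x1, x2], x3] = 1 :> X.
  have [[[a <-] [b <-]] [c <-]] := (pS x1, pS x2, pS x3).
  by rewrite -!(morphR pM); apply/p1/CT; do 2!apply: lower_centralR.
have psP : spans (map p gs).
  move=> A sA As x; have [y <-] := pS x.
  apply: (gsP (A := p @^-1` A)) => [|z zs]; first exact: preimage_subgroup.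
  exact/As/map_f.
have ptau d y : tau d -> commute (p d) (p y).
  by move=> td; apply/commgP/eqP; rewrite -(morphR pM); apply/p1/isolator_commg.
have [r r0 rP] := uniform_commg_root cl2 psP (map p gs) (subgroup_setT X).
(* [t] kills [tau / B], [r] extracts the bracket, [t'] kills [T / C]; all three are fixed before
   [phi]. *)
exists (t * r * t')%N; first by rewrite !muln_gt0 t0 r0.
move=> phi q phiM phi_inj phi_normal phi_index.
have powH x : exists2 m, (0 < m)%N & range phi (x ^+ m).
  have [m [m0 _ xm]] := index_le_expg (subgroup_setT G) phi_index (I :
    [set: G] x).
  by exists m.
have nCH := set_product_normal (lower_central_normal (G := G) 2) phi_normal.
have [Y [h [hM hS hP h1]]] := quotient_group nCH.
have hphi z : range phi z -> h z = 1.
  by move=> Hz; apply/h1; exists 1; [exact: (subg1 sC)|exists z;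
    rewrite ?mul1g].
have hC z : C z -> h z = 1.
  move=> Cz; apply/h1; exists z => //; exists 1; last exact: mulg1.
  by exists 1; rewrite ?(morph1 phiM).
(* The quotient [Y] by [C] and [range phi] has class two, so its derived subgroup is abelian and a
   bound on commutators is enough. *)
suff key x y : h [~ y, x] ^+ (t * r * t') = 1.
  have clY x1 x2 x3 : [~ [~ x1, x2], x3] = 1 :> Y.
    have [[[a <-] [b <-]] [c <-]] := (hS x1, hS x2, hS x3).
    by rewrite -!(morphR hM); apply/hC; do 2!apply: lower_centralR.
  have Bcom b z : B b -> commute (h b) z.
    by move=> Bb; apply: (lower_central1_central clY);
      apply: morph_lower_central.
  move=> x Bx; apply/h1; rewrite (morphX hM).
  suff : B `<=` [set z | B z /\ h z ^+ (t * r * t') = 1] by move=> /(_ x Bx)[].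
  apply: lower_central_ind => [|a b _]; last by split;
    [exact: (@lower_centralR _ 0)|exact: key].
  apply/is_subgroupP; split=> [|a b [Ba ea] [Bb eb]|a [Ba ea]].
  - by split; [exact: (subg1 sB)|rewrite (morph1 hM) expg1n].
  - split; first exact: (subgM sB).
    by rewrite hM expgMn ?ea ?eb ?mulg1 //; apply: Bcom.
  - by split; [exact: (subgV sB)|rewrite (morphV hM) expVgn ea invg1].
have [sg [sgM sgP]] := conj_endo phiM phi_inj phi_normal x.
pose d y := y^-1 * sg y.
have phid z : phi (d z) = [~ phi z, x] by rewrite phiM (morphV phiM) sgP.
have td z : tau (d z).
  have [d' td' /esym] := commg_isolator phiM phi_inj phi_normal phi_index z x.
  by rewrite -phid => /phi_inj ->.
(* [sg] moves each element by a factor in [tau], central modulo [T], which brackets do not see. *)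
have sgB b : B b -> p (sg b) = p b.
  suff: B `<=` [set b | p (sg b) = p b] by move=> H /H.
  apply: lower_central_ind => [|a c _] /=.
    apply/is_subgroupP; split=> [|a c /= ea ec|a /= ea] /=.
    - by rewrite (morph1 sgM).
    - by rewrite sgM !pM ea ec.
    - by rewrite (morphV sgM) !(morphV pM) ea.
  have sgE z : p (sg z) = p z * p (d z) by rewrite -pM mulVKg.
  have cd z u : [~ p (d z), u] = 1.
    by have [v <-] := pS u; apply/eqP/commgP/ptau.
  have dc z u : [~ u, p (d z)] = 1 by rewrite -invgR cd invg1.
  rewrite (morphR sgM) !(morphR pM) !sgE (commgMl cl2) !(commgMr cl2).
  by rewrite !cd !dc !mulg1.
have tauS z n : tau (z^-1 * iter n sg z) /\
    p ((z^-1 * iter n sg z) ^+ t) = p (d z) ^+ t ^+ n.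
  elim: n => [|n [tn en]] /=.
    by rewrite mulVg expg1n (morph1 pM); split=> //; apply: (subg1 stau).
  have -> : z^-1 * sg (iter n sg z) = d z * sg (z^-1 * iter n sg z).
    by rewrite sgM (morphV sgM) /d !gnorm.
  split; first by apply: (subgM stau) => //; apply: isolator_invariant.2.
  rewrite (morphX pM) pM expgMn; last exact: ptau.
  rewrite expgS; congr (_ * _); rewrite -en -(morphX pM) -(morphX sgM).
  by apply: sgB; apply: tP.
have [Q Q0 [w _ wP]] := powH x.
(* Since [x ^+ Q = phi w], the [Q]-th iterate of [sg] is conjugation by [w]. *)
have iterQ z : z^-1 * iter Q sg z = [~ z, w].
  rewrite commgEl; congr (_ * _); apply: phi_inj; rewrite (morphJ phiM) wP.
  by elim: Q {Q0 wP} => [|n IHn] /=; rewrite ?conjg1 // sgP IHn expgSr conjgM.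
have /choice[rep repP] := pS.
pose u z := p (d (rep z)) ^+ t.
have [||z0 _ z0P] := rP u.
- by move=> z _; rewrite /u -(morphX pM); apply: (morph_lower_central pM);
  apply: tP; apply: td.
- exists Q => //; exists (p w ^+ t) => // z _.
  rewrite /u -(tauS _ Q).2 iterQ (morphX pM) (morphR pM) repP.
  by rewrite (commgXr cl2).
have [z1 ez1] := pS z0.
pose v := x ^+ (t * r) * (phi z1)^-1.
have vgs z : z \in gs -> [~ p (phi z), p v] = 1.
  move=> zs; pose z' := rep (p z).
  have ez : p z' = p z by exact: repP.
  have : p (d z' ^+ (t * r)) = p [~ z', z1].
    by rewrite (morphX pM) expgnA (morphR pM) ez1 ez -z0P // map_f.
  move=> /(pf _ phiM); rewrite (morphX phiM) phid (morphR phiM) (morphX pM)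
    !(morphR pM).
  rewrite (pf _ phiM _ _ ez) => e.
  by rewrite pM (morphV pM) (commgMr cl2) (commgVr cl2) (morphX pM) (commgXr
    cl2) e mulgV.
have vphi z : [~ p (phi z), p v] = 1.
  apply: (gsP (A := [set z | [~ p (phi z), p v] = 1])) => //.
  apply/is_subgroupP; split=> [|a b /= ea eb|a /= ea] /=.
  - by rewrite (morph1 phiM) (morph1 pM) comm1g.
  - by rewrite phiM pM (commgMl cl2) ea eb mulg1.
  - by rewrite (morphV phiM) (morphV pM) (commgVl cl2) ea invg1.
(* A power of [y] lies in [range phi], so this bracket is torsion; but [B / T] is torsion-free. *)
have vy : [~ p y, p v] = 1.
  have [m m0 [y' _ yP]] := powH y.
  have : [~ p y, p v] ^+ m = 1.
    by rewrite -(commgXl cl2) -(morphX pM) -yP vphi.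
  rewrite -(morphR pM) -(morphX pM) => /p1[_ [k k0 Ck]].
  apply/p1; split; first exact: (@lower_centralR _ 0).
  by exists (m * k)%N; rewrite ?muln_gt0 ?m0 // expgnA.
have /esym/pP : p ([~ y, x] ^+ (t * r)) = p [~ y, phi z1].
  rewrite (morphX pM) !(morphR pM) -(commgXr cl2) -(morphX pM).
  apply: (@mulIg _ [~ p y, p (phi z1)]^-1).
  by rewrite mulgV -(commgVr cl2) -(commgMr cl2) -(morphV pM) -pM.
(* [g] lies in [range phi] and [b] in [T], so [b ^+ t'] lies in [C]; both disappear in [Y]. *)
set g := [~ y, phi z1]; set b := _ * _ => /t'P Cb.
have -> : h [~ y, x] ^+ (t * r * t') = h ((g * b) ^+ t').
  by rewrite expgnA -(morphX hM) -(morphX hM) mulVKg.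
rewrite (morphX hM) hM (hphi g) ?mul1g -?(morphX hM); first exact: hC.
by apply: (normRr phi_normal); exists z1.
Qed.

End Isolator.

(** * Chains *)

Lemma lower_central_perfect (Y : groupType) c :
  lower_central Y 1 `<=` lower_central Y 2 -> lower_central Y c `<=` [set 1] ->
  lower_central Y 1 `<=` [set 1].
Proof.
move=> Y12 Yc; have YS n : lower_central Y n.+1 `<=` lower_central Y n.+2.
  elim: n => // n IHn; apply: lower_central_ind.
    exact: lower_central_subgroup.
  by move=> x y /IHn; apply: lower_centralR.
have Y1 n : lower_central Y 1 `<=` lower_central Y n.+1.
  by elim: n => // n IHn x /IHn/YS.
by move=> x /(Y1 c)/(lower_central_sub (leqnSn c))/Yc.
Qed.

(** Modulo the term after it, [[x, y]] is central, so [[x, y] ^+ e] is congruent to [[x ^+ e, y]]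
    and the exponent passes down the series. *)
Lemma lower_central_expg (Y : groupType) e :
  (forall x : Y, lower_central Y 1 x -> lower_central Y 2 (x ^+ e)) ->
  forall n x, lower_central Y n.+1 x -> lower_central Y n.+2 (x ^+ e).
Proof.
move=> Y12; elim=> // n IHn.
have [Z [p [pM pS pP p1]]] := quotient_group (lower_central_normal (G :=
  Y) n.+3).
have pC x y : lower_central Y n.+2 x -> commute (p x) (p y).
  by move=> nx; apply/commgP/eqP; rewrite -(morphR pM); apply/p1;
    apply: lower_centralR.
suff : lower_central Y n.+2 `<=`
    [set x | lower_central Y n.+2 x /\ p x ^+ e = 1].
  by move=> H x /H[_]; rewrite -(morphX pM) => /p1.
apply: lower_central_ind => [|x y nx].
  have sn := @lower_central_subgroup Y n.+2.
  apply/is_subgroupP; split=> [|x y [nx ex] [ny ey]|x [nx ex]].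
  - by split; [exact: (subg1 sn)|rewrite (morph1 pM) expg1n].
  - split; first exact: (subgM sn).
    by rewrite pM expgMn ?ex ?ey ?mulg1 //; apply: pC.
  - by split; [exact: (subgV sn)|rewrite (morphV pM) expVgn ex invg1].
split; first exact: lower_centralR.
have -> : p [~ x, y] ^+ e = p [~ x ^+ e, y].
  elim: e {Y12 IHn} => [|k IHk]; first by rewrite comm1g (morph1 pM).
  have -> : [~ x ^+ k.+1, y] = [~ x, y] ^ (x ^+ k) * [~ x ^+ k, y].
    by rewrite expgS /commg /conjg !gnorm.
  rewrite expgS IHk [in RHS]pM; congr (_ * _).
  have nxy : lower_central Y n.+2 [~ x, y] by apply: lower_centralR.
  by rewrite (morphJ pM) conjgE (pC _ _ nxy) mulKg.
by apply/p1; apply: lower_centralR; apply: IHn.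
Qed.

Lemma derived_sub_chain (G : groupType) (gs : seq G) (phi : nat -> G -> G) :
  spans gs ->
  (forall k, {morph phi k : x y / x * y}) -> (forall k, injective (phi k)) ->
  (forall k, normal_subgroup (range (phi k))) ->
  (forall k, exists n, index_le n [set: G] (range (phi k))) ->
  (forall k, range (phi k.+1) `<=` range (phi k)) ->
  exists k, forall l, (k <= l)%N ->
    phi k @` lower_central G 1 `<=` range (phi l).
Proof.
move=> gsP phiM phi_inj phi_normal phi_index phi_decr.
have [e e0 eP] := exponent_bound gsP.
have [C [q [qM qS qP q1]]] := quotient_group (lower_central_normal (G := G) 2).
have qC x y : lower_central G 1 x -> commute (q x) (q y).
  by move=> x1; apply/commgP/eqP; rewrite -(morphR qM); apply/q1;
    apply: lower_centralR.
(* The preimage of the [e]-th powers of the second term modulo the third. *)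
pose W : set G :=
  [set x | exists2 a, lower_central G 1 a & lower_central G 2 ((a ^+ e)^-1 *
    x)].
have WP x : W x <-> exists2 a, lower_central G 1 a & q x = q a ^+ e.
  split=> -[a a1 xa]; exists a => //; first by rewrite -(morphX qM);
    apply/esym/qP.
  by apply/qP; rewrite (morphX qM).
have s1 := @lower_central_subgroup G 1.
have s2 := @lower_central_subgroup G 2.
have fW : fully_invariant W.
  split; last first.
    move=> f fM x [a a1 xa]; exists (f a); first exact: morph_lower_central.
    by rewrite -(morphX fM) -(morphV fM) -fM; apply: morph_lower_central.
  apply/is_subgroupP; split=> [|x y /WP[a a1 xa] /WP[b b1 yb]|x /WP[a a1 xa]];
    apply/WP.
  - by exists 1; [exact: (subg1 s1)|rewrite (morph1 qM) expg1n].
  - exists (a * b); first exact: (subgM s1).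
    by rewrite !qM xa yb expgMn //; apply: qC.
  - by exists a^-1; [exact: (subgV s1)|rewrite !(morphV qM) xa expVgn].
have W2 : lower_central G 2 `<=` W.
  by move=> x x2; exists 1; [exact: (subg1 s1)|rewrite expg1n invg1 mul1g].
have cW : central_mod (lower_central G 1) W.
  split=> //; first by case: fW.
    move=> x [a a1 xa]; rewrite -(mulVKg (a ^+ e) x).
    apply: (subgM s1); first exact: (subgX s1).
    exact: (lower_central_sub (leqnSn 1)) xa.
  by move=> x y x1; apply: W2; apply: lower_centralR.
have [n1 i1] := torsion_mod_finite (central_mod_lower_central G 0)
  (spans_mod_setT _ gsP).
have [|n2 i2] := torsion_mod_finite (s := [seq [~ x, y] | x <- gs, y <- gs]) cW.
  have [sB sP] := spans_mod_commg gsP; split=> // A sA WA; apply: sP => //.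
  by move=> x /W2/WA.
have {}i2 : index_le n2 (lower_central G 1) W.
  apply: index_leS i2 => x x1; split=> //; exists e => //; exists x => //.
  by rewrite mulVg; apply: (subg1 s2).
have iW := index_le_trans s1 i1 i2.
(* [n1 * n2] bounds the index of [W] in the isolator; this is the bound of [low_index_centralise],
   the same for every [phi k]. *)
pose N := ((n1 * n2) ^ size gs)%N.
have [m iF] := low_index_finite N gsP.
have [k kP] := stabilise iF (@subsetT _ (range (phi 0%N))) phi_decr.
have phi_le i j : (i <= j)%N -> range (phi j) `<=` range (phi i).
  move/subnKC <-; elim: (j - i)%N => [|d IHd]; first by rewrite addn0.
  by rewrite addnS => x /phi_decr/IHd.
exists k => l kl.
(* Transport through [phi k] turns the pair [range (phi l)], [range (phi k)] into [range psi], [G],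
   so the results on one endomorphism apply to [psi]. *)
have /choice[psi psiP] x : exists y, phi k y = phi l x.
  by have [|y _ yx] := phi_le _ _ kl (phi l x); [exists x|exists y].
have psiM : {morph psi : x y / x * y}.
  by move=> x y; apply: (phi_inj k); rewrite phiM !psiP phiM.
have psi_inj : injective psi.
  by move=> x y exy; apply: (phi_inj l); rewrite -!psiP exy.
have psi_range : range psi = phi k @^-1` range (phi l).
  apply/seteqP; split=> [_ [x _ <-]|x [y _ yx]] /=; first by exists x.
  by exists y => //; apply: (phi_inj k); rewrite psiP.
have psi_normal : normal_subgroup (range psi).
  by rewrite psi_range; apply: preimage_normal.
have [r [J [f [Jr fP]]]] := phi_index l.
have psi_index : index_le r [set: G] (range psi).
  exists J, (f \o phi k); split=> // x y _ _ exy.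
  by rewrite psi_range /= phiM (morphV (phiM k)); apply: fP.
have [Y [h [hM hS hP h1]]] := quotient_group psi_normal.
have [c cP] := nilpotent_quotient gsP psiM psi_inj psi_normal psi_index.
have [j ij] := phi_index k.
suff Y1 : lower_central Y 1 `<=` [set 1].
  move=> _ [x x1 <-]; suff: range psi x by rewrite psi_range.
  by apply/h1; apply: Y1; apply: morph_lower_central.
apply: (@lower_central_perfect _ c); last first.
  by move=> _ /(lower_central_surj hM hS)[x /cP Ux <-]; apply/h1.
suff GY : lower_central G 1 `<=` [set x | lower_central Y 2 (h x)].
  by move=> _ /(lower_central_surj hM hS)[x /GY x2 <-].
have sY := @lower_central_subgroup Y 2.
apply: lower_central_ind => [|y y' _ /=]; first exact: preimage_subgroup.
(* [phi k y'] is an element of [range (phi l)], invisible in [Y], times one whose bracket with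
   [phi k y] lies in [phi k (W)]. *)
have [_ [z _ <-] Fz] : exists2 z,
  range (phi l) z & low_index G N (z^-1 * phi k y').
  by apply: kP => //; exists y'.
have [w Ww wP] := low_index_centralise gsP (phiM k) (phi_inj k) (phi_normal k)
  ij fW iW y Fz.
have yw : h [~ y, y'] = h w.
  apply/esym/hP; rewrite psi_range /= phiM (morphV (phiM k)) wP (morphR (phiM
    k)).
  set g := _ * phi k y'.
  have -> : [~ phi k y, phi k y'] = [~ phi k y, g] * [~ phi k y, phi l z] ^ g.
    by rewrite /g /commg /conjg !gnorm.
  rewrite mulKg; apply: (normJ (phi_normal l)); apply: (normRr (phi_normal l)).
  by exists z.
(* [w] is [a ^+ e] up to the third term, and [eP] puts [a ^+ e] in that term times [range psi]. *)
have [a a1 aw] := Ww.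
rewrite yw -(mulVKg (a ^+ e) w) hM; apply: (subgM sY);
  last exact: morph_lower_central.
have [b b2 [u Uu buP]] := eP _ _ psiM psi_inj psi_normal psi_index _ a1.
by rewrite -buP hM (h1 u).2 // mulg1; apply: morph_lower_central.
Qed.

(** The given map is multiplicative on [H] only; its inverse is a homomorphism on all of [G]. *)
Lemma isomorphic_regular (G : groupType) (H : set G) : is_subgroup H ->
  isomorphic_subgroups H [set: G] ->
  exists phi : G -> G,
    [/\ {morph phi : x y / x * y}, injective phi & range phi = H].
Proof.
move=> sH [f [[_ f_inj fS] fM]].
have /choice[phi phiP] y : exists x, H x /\ f x = y.
  by have [x Hx xy] := fS y I; exists x.
have phiH y : H (phi y) by case: (phiP y).
have phiK y : f (phi y) = y by case: (phiP y).
have f_injH x y : H x -> H y -> f x = f y -> x = y.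
  by move=> Hx Hy; apply: f_inj; rewrite inE.
exists phi; split=> [x y|x y exy|].
- by apply: f_injH; rewrite ?fM ?phiK //; apply: subgM.
- by rewrite -[x]phiK exy phiK.
- apply/seteqP; split=> [_ [x _ <-]//|x Hx]; exists (f x) => //.
  by apply: f_injH => //; rewrite phiK.
Qed.

(** * The quotient by the intersection of the chain *)

Theorem corollary1p4 (G : groupType) (Gamma : nat -> set G)
    (G_fg : finitely_generated G)
    (Gamma_normal : forall k : nat, normal_subgroup (Gamma k))
    (Gamma_index : forall k : nat, finite_index (Gamma k))
    (Gamma_decr : forall k : nat, Gamma k.+1 `<=` Gamma k)
    (Gamma_iso : forall k : nat, isomorphic_subgroups (Gamma k) [set: G]) :
  exists N : groupType,
    [/\ finitely_generated N, nilpotent_group N,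
        abelian_quotient (torsion N)
      & exists pi : {multiplicative G -> N},
          set_surj [set: G] [set: N] pi /\
          exists Nk : nat -> set N, forall k : nat, (1 <= k)%N ->
            [/\ normal_subgroup (Nk k), finite_index (Nk k)
              & Gamma k = pi @^-1` Nk k]].
Proof.
have sGamma k : is_subgroup (Gamma k) by case: (Gamma_normal k).
have Gamma_le i j : (i <= j)%N -> Gamma j `<=` Gamma i.
  move/subnKC <-; elim: (j - i)%N => [|d IHd]; first by rewrite addn0.
  by rewrite addnS => x /Gamma_decr/IHd.
have [gs gsP] := finitely_generated_spans G_fg.
have /choice[phi phiP] k := isomorphic_regular (sGamma k) (Gamma_iso k).
have phiM k : {morph phi k : x y / x * y} by case: (phiP k).
have phi_inj k : injective (phi k) by case: (phiP k).
have phi_range k : range (phi k) = Gamma k by case: (phiP k).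
have phi_normal k : normal_subgroup (range (phi k)) by rewrite phi_range.
have phi_index k : exists n, index_le n [set: G] (range (phi k)).
  by rewrite phi_range; apply: finite_index_le.
pose M : set G := [set x | forall k, Gamma k x].
have nM : normal_subgroup M.
  split=> [|x y Mx k]; last exact: (normJ (Gamma_normal k)).
  apply/is_subgroupP; split=> [k|x y Mx My k|x Mx k].
  - exact: subg1.
  - by apply: subgM.
  - by apply: subgV.
have MGamma k : M `<=` Gamma k by move=> x; apply.
have GammaM l x : (forall j, (l <= j)%N -> Gamma j x) -> M x.
  move=> lx j; apply: (Gamma_le _ (maxn l j)); first exact: leq_maxr.
  by apply: lx; apply: leq_maxl.
have [N [p [pM pS pP p1]]] := quotient_group nM.
exists N.
have [k kP] : exists k, phi k @` lower_central G 1 `<=` M.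
  have [|k kP] := derived_sub_chain gsP phiM phi_inj phi_normal phi_index.
    by move=> k; rewrite !phi_range.
  exists k => x xk; apply: (GammaM k) => l kl; rewrite -phi_range.
  exact: kP kl _ xk.
have [n nN] : exists n, lower_central G n `<=` M.
  have nilp l : exists c, lower_central G c `<=` Gamma l.
    have [i il] := phi_index l; rewrite -phi_range.
    exact: nilpotent_quotient gsP (phiM l) (phi_inj l) (phi_normal l) il.
  have [i ti] := torsion_mod_finite (central_mod_lower_central G 0)
    (spans_mod_setT _ gsP).
  (* [phi k] sends the derived subgroup into [M], so [D] is finite modulo [M]. *)
  pose D := phi k @` torsion_mod [set: G] (lower_central G 1).
  have iD : index_le i D M.
    have [I [f [Ii fP]]] := index_le_image (phiM k) (phi_inj k) ti.
    by exists I, f; split=> // x y Dx Dy exy; apply/kP/fP.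
  (* Once these intersections are stable modulo [M], each element agrees modulo [M] with elements of
     all later [Gamma j]. *)
  have [l lP] : exists l, D `&` Gamma l `<=` M.
    have [||l lP] := stabilise (A := fun l => D `&` Gamma l) iD.
    - by move=> x [].
    - by move=> l x [Dx /Gamma_decr].
    exists l => x Dx; apply: (GammaM l) => j /lP/(_ _ Dx)[y [_ yj] /(_ j) xj].
    by rewrite -(mulVKg y x); apply: subgM.
  (* Term [c] lies in [Gamma k], so term [c.+1] lies in [D] by [commg_isolator], while term [c']
     lies in [Gamma l]. *)
  have [[c cP] [c' c'P]] := (nilp k, nilp l).
  exists (maxn c.+1 c') => x xc; apply: lP; split; last first.
    by apply: c'P; apply: (lower_central_sub (leq_maxr c.+1 c')) xc.
  have : lower_central G c.+1 x by apply: (lower_central_sub (leq_maxl c.+1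
    c')) xc.
  have sD : is_subgroup D.
    apply: (image_subgroup (phiM k)); apply: torsion_mod_subgroup.
    exact: (central_mod_lower_central G 0).
  move: x {xc}; apply: lower_central_ind => // x g /cP;
    rewrite -phi_range => -[y _ <-].
  have [r ik] := phi_index k.
  by have [d td dP] := commg_isolator gsP (phiM k) (phi_inj k) (phi_normal k)
    ik y g; exists d.
have torM x : lower_central G 1 x -> exists2 m, (0 < m)%N & M (x ^+ m).
  have [e e0 eP] := exponent_bound gsP.
  (* In each [G / Gamma l] every [e]-th power descends one term of the series, and term [n] is
     trivial there. *)
  move=> x1; exists (e ^ n)%N; first by rewrite expn_gt0 e0.
  move=> l; have [Y [h [hM hS hP h1]]] := quotient_group (Gamma_normal l).
  have Y12 z : lower_central Y 1 z -> lower_central Y 2 (z ^+ e).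
    move=> /(lower_central_surj hM hS)[y y1 <-].
    have [r il] := phi_index l.
    have [b b2 [u]] := eP _ _ (phiM l) (phi_inj l) (phi_normal l) il _ y1.
    rewrite phi_range => /h1 u1 buP; rewrite -(morphX hM) -buP hM u1 mulg1.
    exact: morph_lower_central.
  have : lower_central Y n.+1 (h x ^+ (e ^ n)).
    elim: n {nN} => [|j IHj]; first exact: (morph_lower_central hM).
    by rewrite expnSr expgnA; apply: lower_central_expg.
  rewrite -(morphX hM) => /(lower_central_sub (leqnSn n)).
  by move=> /(lower_central_surj hM hS)[y /nN My];
    rewrite (h1 y).2 // => /esym/h1.
(* As the derived subgroup of [N] is torsion, being torsion modulo it is being torsion; hence
   [torsion N] is a normal subgroup with abelian quotient. *)
have torE : torsion N = torsion_mod [set: N] (lower_central N 1).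
  have s1 := @lower_central_subgroup N 1.
  apply/seteqP; split=> [z [m m0 zm]|z [_ [m m0 zm]]].
    by split=> //; exists m => //; rewrite zm; apply: (subg1 s1).
  have [y /torM[j j0 My] yz] := lower_central_surj pM pS zm.
  exists (m * j)%N; first by rewrite muln_gt0 m0.
  by rewrite expgnA -yz -(morphX pM); apply/p1.
have ntor : normal_subgroup (torsion N).
  by rewrite torE; apply/fully_invariant_normal/isolator_invariant.
split.
- have [S finS gS] := G_fg; exists (p @` S); first exact: finite_image.
  apply/seteqP; split=> // z _; have [x <-] := pS z.
  have : generated S x by rewrite gS.
  move=> /(_ (p @^-1` generated (p @` S))); apply; split.
    exact/(preimage_subgroup pM)/generated_subgroup.
  by move=> y Sy A [_]; apply; exists y.
- exists n; apply/seteqP; split=> [_ /(lower_central_surj pM pS)[x /nN/p1 +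
  <-]//|_ ->].
  exact/subg1/lower_central_subgroup.
- have [Z [r [rM rS rP r1]]] := quotient_group ntor.
  have rC x y : r x * r y = r y * r x.
    apply/commgP/eqP; rewrite -(morphR rM); apply/r1; rewrite torE.
    split=> //; exists 1%N => //; exact: (@lower_centralR _ 0).
  have half a b : set_product (left_coset a (torsion N)) (left_coset b (torsion
    N)) `<=`
      set_product (left_coset b (torsion N)) (left_coset a (torsion N)).
    move=> _ [_ [t Tt <-] [_ [t' Tt' <-] <-]].
    exists (b * (b^-1 * (a * t * (b * t')) * a^-1)).
      exists (b^-1 * (a * t * (b * t')) * a^-1) => //; apply/r1.
      rewrite !rM !(morphV rM) ((r1 t).2 Tt) ((r1 t').2 Tt') !mulg1.
      by rewrite (rC a b) mulKg mulgV.
    exists (a * 1); first by exists 1 => //; apply: subg1; case: ntor.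
    by rewrite !gnorm.
  by move=> _ _ [a _ <-] [b _ <-]; apply/seteqP; split; apply: half.
- pose pi : {multiplicative G -> N} :=
  HB.pack p (isMultiplicative.Build G N p pM).
  exists pi; split; first by move=> z _; have [x xz] := pS z; exists x.
  exists (fun k => p @` Gamma k) => l _.
  have sl : is_subgroup (p @` Gamma l) by apply: image_subgroup.
  split.
  + split=> // _ z [x xl <-]; have [y <-] := pS z.
    by exists (x ^ y); [exact: (normJ (Gamma_normal l))|rewrite (morphJ pM)].
  + have [i [I [f [Ii fP]]]] := phi_index l.
    have /choice[rep repP] := pS.
    apply: (@index_le_finite _ i) => //; exists I, (f \o rep).
    split=> // z z' _ _ exy.
    have Gz : Gamma l ((rep z)^-1 * rep z') by rewrite -phi_range; apply: fP.
    exists ((rep z)^-1 * rep z') => //.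
    by rewrite pM (morphV pM) !repP.
  + apply/seteqP; split=> [x xl|x [y yl /pP yx]]; first by exists x.
    by rewrite -(mulVKg y x); apply: subgM => //; apply: MGamma.
Qed.
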